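(* Let $q\in(0,1]$, $s>0$, and consider the ReLU network with dropout $x^{(k+1)}=\phi_0(W^{(k+1)}x^{(k)})\odot\varepsilon^{(k+1)}$. Define $$q_d(n)=\binom dn\Big(\frac q2\Big)^n\Big(1-\frac q2\Big)^{d-n},\qquad I_{0,q}(s,d)=\frac{2^{s/2}}{q^s}\sum_{n=1}^dq_d(n)\frac{\Gamma(n/2+s/2)}{\Gamma(n/2)}.$$ Then $\mathbb E\|x^{(k)}\|^s=\|x^{(0)}\|^s(\sigma^sI_{0,q}(s,d))^k$ for all $k\ge0$. With $\bar\sigma_{0,q}(s,d)=I_{0,q}(s,d)^{-1/s}$ and $x^{(0)}\neq0$: (i) if $\sigma=\bar\sigma_{0,q}(s,d)$ then $\mathbb E\|x^{(k)}\|^s=\|x^{(0)}\|^s$ for all $k\ge1$ while $\mathbb E\|x^{(k)}\|^p\to\infty$ exponentially fast for every $p>s$; (ii) if $\sigma<\bar\sigma_{0,q}(s,d)$ then $\mathbb E\|x^{(k)}\|^s\to0$ exponentially fast; (iii) if $\sigma>\bar\sigma_{0,q}(s,d)$ then $\mathbb E\|x^{(k)}\|^s\to\infty$ exponentially fast.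
   Context: $d\ge1$ is the width; $\phi_0(z)=\max(z,0)$ applied componentwise; $\sigma>0$; $x^{(0)}\in\mathbb R^d$ is deterministic; the matrices $W^{(1)},W^{(2)},\dots\in\mathbb R^{d\times d}$ have i.i.d. $\mathcal N(0,\sigma^2)$ entries; the dropout vectors $\varepsilon^{(1)},\varepsilon^{(2)},\dots\in\mathbb R^d$ are independent of the weights and have i.i.d. components with $\mathbb P(\varepsilon_i^{(k)}=0)=1-q$ and $\mathbb P(\varepsilon_i^{(k)}=1/q)=q$; $\odot$ is componentwise multiplication; $\|\cdot\|$ is the Euclidean norm. *)

(* Defs.v *)
From HB Require Import structures.
From mathcomp Require Import all_boot all_order all_algebra.
From mathcomp Require Import all_classical all_reals all_analysis.
Set Implicit Arguments.
Unset Strict Implicit.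
Unset Printing Implicit Defensive.
Import Order.TTheory GRing.Theory Num.Def Num.Theory.
Local Open Scope classical_set_scope.
Local Open Scope ring_scope.

Section defs.
Context {R : realType}.

Definition Gamma (x : R) : R :=
  fine (\int[lebesgue_measure]_(t in `]0%R, +oo[) (t `^ (x - 1) * expR (- t))%:E).

Definition qd (q : R) (d n : nat) : R :=
  'C(d, n)%:R * (q / 2) ^+ n * (1 - q / 2) ^+ (d - n).

Definition I0q (q s : R) (d : nat) : R :=
  2 `^ (s / 2) / q `^ s *
  \sum_(1 <= n < d.+1) qd q d n * (Gamma (n%:R / 2 + s / 2) / Gamma (n%:R / 2)).

Definition sigma_bar (q s : R) (d : nat) : R := I0q q s d `^ (- s^-1).

Definition enorm (d : nat) (x : 'I_d -> R) : R := Num.sqrt (\sum_i x i ^+ 2).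

Definition relu (z : R) : R := Num.max z 0.

(** The network: net 0 = x0 ; net (k+1) = phi_0(W^(k+1) net k) .* eps^(k+1).
    Indexing convention: [W k] is W^(k+1) and [eps k] is eps^(k+1). *)
Fixpoint net {T : Type} (d : nat) (W : nat -> 'I_d -> 'I_d -> T -> R)
    (eps : nat -> 'I_d -> T -> R) (x0 : 'I_d -> R) (k : nat) (w : T) : 'I_d -> R :=
  match k with
  | 0 => x0
  | k'.+1 => fun i =>
      relu (\sum_j W k' i j w * net W eps x0 k' w j) * eps k' i w
  end.

Definition mutually_independent {dT : measure_display} {T : measurableType dT}
    (P : probability T R) {I : eqType} (X : I -> T -> R) : Prop :=
  forall (s : seq I) (B : I -> set R), uniq s -> (forall i, measurable (B i)) ->
    P (\bigcap_(i in [set` s]) (X i @^-1` B i)) =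
    (\prod_(i <- s) fine (P (X i @^-1` B i)))%:E.

Definition all_vars {T : Type} (d : nat) (W : nat -> 'I_d -> 'I_d -> T -> R)
    (eps : nat -> 'I_d -> T -> R) :
    ((nat * 'I_d * 'I_d) + (nat * 'I_d))%type -> T -> R :=
  fun a => match a with
           | inl (k, i, j) => W k i j
           | inr (k, i) => eps k i
           end.

End defs.

(* Main.v *)
Require Import Defs.
From HB Require Import structures.
From mathcomp Require Import all_boot all_order all_algebra.
From mathcomp Require Import all_classical all_reals all_analysis.
From mathcomp Require Import measurable_realfun ring lra.
Import Order.TTheory GRing.Theory Num.Def Num.Theory.
Import numFieldNormedType.Exports.
Local Open Scope classical_set_scope.
Local Open Scope ring_scope.

Set Implicit Arguments.
Unset Strict Implicit.
Unset Printing Implicit Defensive.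

(* One layer acts on a fixed vector v as follows.  By Gaussian stability every
   preactivation is sigma |v| z with z standard normal, so a squared output is 0
   with probability 1 - q/2 and otherwise rho t, where rho = 2 sigma^2 |v|^2 / q^2
   and t = z^2 / 2 has the Gamma(1/2) law.  Gamma laws convolve, hence |output|^2
   is rho times a Gamma(n/2) variable, n being binomial(d, q/2), and its moment of
   order s/2 is |v|^s sigma^s I_{0,q}(s,d).  Layers are chained by integrating out
   one weight or dropout variable at a time: each is independent of the
   sigma-algebra of the variables already used, so Tonelli applies.  Part (i) for
   p > s uses k u <= u^k + (k - 1) with k = p/s, which is strict on the event of
   probability at least (1 - q/2)^d where the output vanishes. *)

(** * Measures with density and changes of variables *)

(** The input of a layer is itself random, so its preactivations are Gaussian only conditionally on
    the past. No conditional law is formed: each law is stated as an identity between integrals of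
    g(Y w, w), where the test function g is nonnegative and measurable in its second argument for
    the sigma-algebra of the past. This form survives induction, because averaging over one variable
    yields a test function of the same kind over a smaller past. All integrals are nonnegative and
    extended-valued, so Tonelli applies with no prior knowledge that a moment is finite. Normalising
    constants are not computed by special integrals. Testing an identity with the constant function
    1 and comparing total masses gives both the constant relating the Gaussian density to Gamma(1/2)
    and the Beta integral. *)

Section density.
Local Open Scope ereal_scope.
Context d (T : measurableType d) (R : realType).
Variables (mu : {measure set T -> \bar R}) (g : T -> R).
Hypotheses (mg : measurable_fun setT g) (g0 : forall x, (0 <= g x)%R).

Import HBNNSimple.

(** On indicators this is the density hypothesis; linearity gives simple functions and monotone
    convergence the rest. The density is an equation on sets so that both [mdensity] and
    [normal_prob] qualify. *)
Lemma ge0_integral_density (nu : {measure set T -> \bar R}) (f : T -> \bar R) :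
  (forall A, measurable A -> nu A = \int[mu]_(x in A) (g x)%:E) ->
  measurable_fun setT f -> (forall x, 0 <= f x) ->
  \int[nu]_x f x = \int[mu]_x (f x * (g x)%:E).
Proof.
move=> nuE mf f0.
have mgE : measurable_fun setT (EFin \o g) by exact/measurable_EFinP.
pose h := nnsfun_approx measurableT mf.
have hE x : f x = limn (fun n => (h n x)%:E).
  by apply/esym/cvg_lim => //; exact: cvg_nnsfun_approx.
have -> : \int[nu]_x f x = limn (fun n => \int[nu]_x (h n x)%:E).
  rewrite -monotone_convergence//.
  - by apply: eq_integral => x _; rewrite hE.
  - by move=> n; exact/measurable_EFinP/measurable_funP.
  - by move=> n x _; rewrite lee_fin.
  - by move=> x _ m n mn; rewrite lee_fin; exact/lefP/nd_nnsfun_approx.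
have -> : \int[mu]_x (f x * (g x)%:E) =
    limn (fun n => \int[mu]_x ((h n x)%:E * (g x)%:E)).
  rewrite -monotone_convergence//.
  - apply: eq_integral => x _; apply/esym/cvg_lim => //; apply: cvgeZr => //.
    exact: cvg_nnsfun_approx.
  - move=> n; apply: emeasurable_funM => //.
    exact/measurable_EFinP/measurable_funP.
  - by move=> n x _; rewrite mule_ge0 ?lee_fin.
  - move=> x _ m n mn; rewrite lee_wpmul2r ?lee_fin//.
    exact/lefP/nd_nnsfun_approx.
congr (limn _); apply/funext => n.
transitivity (\int[nu]_x
   (\sum_(y \in range (h n)) (y * \1_(h n @^-1` [set y]) x)%:E)).
  by apply: eq_integral => t _; rewrite /= fimfunE -fsumEFin.
have mh r : measurable (h n @^-1` [set r]) by exact: measurable_sfunP.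
have indich r : measurable_fun setT (fun x => (r * \1_(h n @^-1` [set r]) x)%:E).
  by apply/measurable_EFinP; apply: measurable_funM.
rewrite ge0_integral_fsum//; last by move=> m y Ey; exact: nnfun_muleindic_ge0.
transitivity (\int[mu]_x (\sum_(y \in range (h n))
    (y * \1_(h n @^-1` [set y]) x)%:E * (g x)%:E)); last first.
  apply: eq_integral => x _.
  rewrite -ge0_mule_fsuml => [|y]; last exact: nnfun_muleindic_ge0.
  by rewrite fsumEFin // -(fimfunE _ x).
rewrite ge0_integral_fsum//; last 2 first.
  - by move=> y; apply: emeasurable_funM.
  - move=> m y Ey; apply: mule_ge0; last by rewrite lee_fin.
    exact: nnfun_muleindic_ge0.
apply: eq_fsbigr => r rhn.
have r0 : (0 <= r)%R by move: rhn; rewrite inE => -[x _ <-].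
under eq_integral do rewrite EFinM.
rewrite integralZl_indic_nnsfun => //.
under [RHS]eq_integral do rewrite EFinM -muleA.
rewrite ge0_integralZl//; last 2 first.
- by apply: emeasurable_funM => //; exact/measurable_EFinP.
- by move=> x _; rewrite mule_ge0 ?lee_fin.
congr *%E; rewrite integral_indic// setIT nuE// integral_mkcond.
by apply: eq_integral => x _; rewrite epatch_indic/= muleC.
Qed.

Definition mdensity of measurable_fun setT g & (forall x, (0 <= g x)%R) :
  set T -> \bar R := fun A => \int[mu]_(x in A) (g x)%:E.

Local Notation md := (mdensity mg g0).

Let md0 : md set0 = 0. Proof. by rewrite /mdensity integral_set0. Qed.

Let md_ge0 A : 0 <= md A.
Proof. by apply: integral_ge0 => x _; rewrite lee_fin. Qed.

Let md_sigma_additive : semi_sigma_additive md.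
Proof.
move=> F mF tF mUF; rewrite /mdensity ge0_integral_bigcup//.
- by apply: is_cvg_ereal_nneg_natsum_cond => n _ _; exact: md_ge0.
- by apply/measurable_EFinP; exact: measurable_funTS.
- by move=> x _; rewrite lee_fin.
Qed.

HB.instance Definition _ := isMeasure.Build _ _ _ md md0 md_ge0 md_sigma_additive.

End density.

Section change_of_variables.
Context {R : realType}.
Local Notation mu := (@lebesgue_measure R).
Local Open Scope ereal_scope.

(** The preimage of ]a, b] under [F] is ]G a, G b], so the image of g dx gives ]a, b] its length,
    and Lebesgue measure is determined by such intervals. The order condition linking [F] and [G]
    replaces differentiability of [F]. *)
Lemma lebesgue_measure_pushforward_density (F G g : R -> R) (f : R -> \bar R)
    (mg : measurable_fun setT g) (g0 : forall x, (0 <= g x)%R) :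
  measurable_fun setT F ->
  (forall x y, (x < F y)%R = (G x < y)%R) ->
  (forall a b, (a < b)%R -> \int[mu]_(x in `]G a, G b]) (g x)%:E = (b - a)%:E) ->
  measurable_fun setT f -> (forall x, 0 <= f x) ->
  \int[mu]_x (f (F x) * (g x)%:E) = \int[mu]_x f x.
Proof.
move=> mF FG gE mf f0.
pose nu : {measure set _ -> \bar R} := mdensity mu mg g0.
pose pf : {measure set (measurableTypeR R) -> \bar R} :=
  pushforward nu (F : measurableTypeR R -> measurableTypeR R).
rewrite -(@ge0_integral_density _ _ _ mu g mg g0 nu (f \o F))//;
  [|exact: measurableT_comp|by move=> x; exact: f0].
transitivity (\int[pf mF]_x f x).
  by rewrite /pf ge0_integral_pushforward// preimage_setT.
apply: eq_measure_integral => A mA _; apply/esym/lebesgue_measure_unique => //.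
move=> _ [[a b]] _ <- /=; rewrite lebesgue_measure_itv/= lte_fin.
have [ab|ba] := ltP a b.
  rewrite /pf /pushforward/= /nu /mdensity -EFinB -gE//.
  rewrite (_ : F @^-1` _ = `]G a, G b]%classic)//.
  apply/seteqP; split => x /=; rewrite !in_itv/= -FG => /andP[-> /=];
    by rewrite !leNgt FG.
apply/esym; rewrite (_ : `]a, b]%classic = set0) ?measure0//.
by apply/seteqP; split => // x/=; rewrite in_itv/= => /andP[/lt_le_trans/[apply]];
  rewrite ltNge ba.
Qed.

Lemma ge0_integral_affine (a b : R) (f : R -> \bar R) : (0 < b)%R ->
  measurable_fun setT f -> (forall x, 0 <= f x) ->
  \int[mu]_x (f (a + b * x)%R * b%:E) = \int[mu]_x f x.
Proof.
move=> b0 mf f0.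
apply: (@lebesgue_measure_pushforward_density (fun x => a + b * x)%R
   (fun y => (y - a) / b)%R (fun=> b) f) => //.
- by move=> _; exact: ltW.
- by apply: measurable_funD => //; exact: measurable_funM.
- by move=> x y; rewrite ltr_pdivrMr// ltrBlDl [(y * b)%R]mulrC.
- move=> x y xy; rewrite integral_cst//= lebesgue_measure_itv/= lte_fin.
  rewrite ltr_pM2r ?invr_gt0// ltrD2r xy -EFinB -EFinM; congr EFin.
  by field; rewrite gt_eqF.
Qed.

Lemma ge0_integral_oppr (f : R -> \bar R) :
  measurable_fun setT f -> (forall x, 0 <= f x) ->
  \int[mu]_x f (- x)%R = \int[mu]_x f x.
Proof.
move=> mf f0.
rewrite -[RHS](_ : \int[pushforward mu (-%R : _ -> measurableTypeR R)]_x f x = _).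
  by rewrite ge0_integral_pushforward// preimage_setT.
by apply: eq_measure_integral => A mA _; exact: lebesgue_measureN.
Qed.

End change_of_variables.

(** * The substitution t = x^2 / 2 on the positive half-line *)

Section square.
Context {R : realType}.
Local Notation mu := (@lebesgue_measure R).
Local Open Scope ereal_scope.

Lemma integral_itv_mulr (e c d : R) : (c <= d)%R ->
  \int[mu]_(x in `]c, d]) (e * x)%:E = (e * (d ^+ 2 - c ^+ 2) / 2)%:E.
Proof.
rewrite le_eqVlt => /predU1P[->|cd].
  by rewrite set_itv_ge ?bnd_simp ?ltxx// integral_set0 subrr mulr0 mul0r.
have cid : continuous (fun x : R => e * x)%R.
  by move=> x; apply: cvgM; [exact: cvg_cst|exact: cvg_id].
have cF : continuous (fun x : R => e * x ^+ 2 / 2)%R.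
  move=> x; apply: cvgM; last exact: cvg_cst.
  by apply: cvgM; [exact: cvg_cst|exact: exprn_continuous].
have dF (x : R) : is_derive x 1%R (fun x : R => e * x ^+ 2 / 2)%R (e * x)%R.
  apply: is_derive_eq.
  by rewrite /GRing.scale/=; field.
rewrite integral_itv_obnd_cbnd; last first.
  by apply: measurable_funTS; apply/measurable_EFinP; apply: measurable_funM.
rewrite (@continuous_FTC2 _ (fun x => e * x)%R (fun x => e * x ^+ 2 / 2)%R)//.
- by rewrite -EFinB; congr EFin; field.
- exact: continuous_subspaceT.
- split.
  + by move=> x _; exact: ex_derive.
  + by apply: cvg_at_right_filter; exact: cF.
  + by apply: cvg_at_left_filter; exact: cF.
- by move=> x _; rewrite derive1E; exact: derive_val.
Qed.

(** The antiderivative x|x|/2 is increasing on the whole line, as the pushforward lemma requires of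
    [F]. The interval is split at 0, where the slope of |x| changes sign. *)
Lemma integral_itv_norm (c d : R) : (c <= d)%R ->
  \int[mu]_(x in `]c, d]) `|x|%:E = (d * `|d| / 2 - c * `|c| / 2)%:E.
Proof.
have pos (a b : R) : (0 <= a)%R -> (a <= b)%R ->
    \int[mu]_(x in `]a, b]) `|x|%:E = (b * `|b| / 2 - a * `|a| / 2)%:E.
  move=> a0 ab; rewrite !ger0_norm ?(le_trans a0 ab)//.
  transitivity (\int[mu]_(x in `]a, b]) (1 * x)%:E).
    apply: eq_integral => x; rewrite mem_setE in_itv/= => /andP[ax xb].
    by rewrite mul1r ger0_norm// (le_trans a0 (ltW ax)).
  by rewrite integral_itv_mulr//; congr EFin; field.
have neg (a b : R) : (a <= b)%R -> (b <= 0)%R ->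
    \int[mu]_(x in `]a, b]) `|x|%:E = (b * `|b| / 2 - a * `|a| / 2)%:E.
  move=> ab b0; rewrite !ler0_norm ?(le_trans ab b0)//.
  transitivity (\int[mu]_(x in `]a, b]) (-1 * x)%:E).
    apply: eq_integral => x; rewrite mem_setE in_itv/= => /andP[ax xb].
    by rewrite mulN1r ler0_norm// (le_trans xb b0).
  by rewrite integral_itv_mulr//; congr EFin; field.
move=> cd; have [c0|c0] := leP 0%R c; first by rewrite pos.
have [d0|d0] := leP d 0%R; first by rewrite neg.
have -> : `]c, d]%classic = `]c, 0%R] `|` `]0%R, d].
  by rewrite -itv_bndbnd_setU// bnd_simp ltW.
rewrite ge0_integral_setU//.
- apply: (etrans (congr2 +%E (neg _ _ (ltW c0) (lexx _)) (pos _ _ (lexx _) (ltW d0)))).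
  by rewrite -EFinD; congr EFin; ring.
- by apply: measurable_funTS; apply/measurable_EFinP; exact: normr_measurable.
- apply/disj_set2P; apply/seteqP; split => // x [] /=; rewrite !in_itv/=.
  by move=> /andP[_ x0] /andP[]; rewrite ltNge x0.
Qed.

(** Since x^2/2 is not injective on the line, the substitution uses its odd extension [F], with
    inverse [G] and density |x|, applied to [f] cut off outside the positive half-line. *)
Lemma ge0_integral_half_sqr (f : R -> \bar R) :
  measurable_fun setT f -> (forall x, 0 <= f x) ->
  \int[mu]_(x in `]0%R, +oo[) (f (x ^+ 2 / 2)%R * x%:E) =
  \int[mu]_(t in `]0%R, +oo[) f t.
Proof.
move=> mf f0; pose F (x : R) := (x * `|x| / 2)%R.
pose G (y : R) := (if (0 <= y)%R then Num.sqrt (2 * y) else - Num.sqrt (2 * - y))%R.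
have FM x y : (x < y)%R -> (F x < F y)%R.
  rewrite /F ltr_pM2r ?invr_gt0// => xy.
  have [x0|x0] := leP 0%R x.
    by rewrite !ger0_norm ?(le_trans x0 (ltW xy))//; nra.
  have [y0|y0] := leP 0%R y.
    by rewrite ltr0_norm// ger0_norm//; nra.
  by rewrite !ltr0_norm//; nra.
have GK y : F (G y) = y.
  rewrite /F /G; case: leP => y0.
    rewrite ger0_norm ?sqrtr_ge0// -expr2 sqr_sqrtr ?mulr_ge0//.
    by field.
  rewrite normrN ger0_norm ?sqrtr_ge0// mulNr -expr2 sqr_sqrtr; last first.
    by rewrite mulr_ge0// oppr_ge0 ltW.
  by field.
have FG x y : (x < F y)%R = (G x < y)%R.
  rewrite -{1}[x]GK; have [|xy|->] := ltgtP (G x) y; last by rewrite ltxx.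
    by move/FM.
  by apply/negbTE; rewrite -leNgt ltW// FM.
have mF : measurable_fun setT F.
  by apply: measurable_funM => //; apply: measurable_funM => //.
have mD : measurable_fun setT (f \_ `]0%R, +oo[).
  apply/(measurable_restrictT _ _).1 => //; exact: measurable_funTS.
rewrite [RHS]integral_mkcond.
rewrite -(@lebesgue_measure_pushforward_density _ F G normr _ _ _ mF FG _ mD)//.
- rewrite [LHS]integral_mkcond; apply: eq_integral => x _.
  rewrite !patchE.
  have -> : (F x \in `]0%R, +oo[%classic) = (x \in `]0%R, +oo[%classic).
    rewrite !mem_setE !in_itv/= !andbT FG /G lexx mulr0 sqrtr0//.
  case: ifPn => [|_]; last by rewrite mul0e.
  rewrite mem_setE in_itv/= andbT => x0.
  by rewrite /F gtr0_norm// expr2.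
- by move=> a b ab; rewrite integral_itv_norm -/(F _) -/(F _) ?GK// ltW// -FG GK.
- by move=> x; apply: erestrict_ge0.
Qed.

End square.

(** * Gaussian integrals *)

Section gaussian.
Context {R : realType}.
Local Notation mu := (@lebesgue_measure R).
Local Notation N := (@normal_prob R 0 1).
Local Notation phi := (@normal_pdf R 0 1).
Local Open Scope ereal_scope.
Implicit Type f : R -> \bar R.

Lemma ge0_integral_normal_prob (m s : R) f :
  measurable_fun setT f -> (forall x, 0 <= f x) ->
  \int[normal_prob m s]_z f z = \int[mu]_z (f z * (normal_pdf m s z)%:E).
Proof.
move=> mf f0; apply: (@ge0_integral_density _ _ _ mu (normal_pdf m s)) => //.
- exact: measurable_normal_pdf.
- exact: normal_pdf_ge0.
Qed.

Lemma integral_normal_prob_cst (m s : R) (k : \bar R) :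
  \int[normal_prob m s]_z k = k.
Proof.
rewrite integral_cst// [X in _ * X](_ : _ = 1) ?mule1//.
exact: (@probability_setT _ _ _ (normal_prob m s)).
Qed.

Lemma normal_pdf01E x : phi x = (normal_peak 1 * expR (- x ^+ 2 / 2))%R.
Proof.
by rewrite normal_pdfE ?oner_eq0// /normal_fun subr0 expr1n.
Qed.

Lemma normal_pdf01N x : phi (- x)%R = phi x.
Proof. by rewrite !normal_pdf01E sqrrN. Qed.

Lemma normal_prob_scale (s : R) f : (0 < s)%R ->
  measurable_fun setT f -> (forall x, 0 <= f x) ->
  \int[normal_prob 0 s]_z f z = \int[N]_z f (s * z)%R.
Proof.
move=> s0 mf f0; apply: (etrans (ge0_integral_normal_prob 0%R s mf f0)).
have mfs : measurable_fun setT (fun z => f (s * z)%R).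
  by apply: measurableT_comp => //; apply: measurable_funM.
apply/esym/(etrans (ge0_integral_normal_prob 0%R 1%R mfs (fun z => f0 _))).
pose g z := f z * (normal_pdf 0 s z)%:E.
have mg : measurable_fun setT g.
  apply: emeasurable_funM => //; apply/measurable_EFinP.
  exact: measurable_normal_pdf.
have g0 z : 0 <= g z by rewrite mule_ge0// lee_fin normal_pdf_ge0.
apply: etrans (ge0_integral_affine 0%R s0 mg g0).
apply: eq_integral => x _; rewrite /g add0r -muleA; congr *%E.
rewrite -EFinM; congr EFin; rewrite normal_pdf01E normal_pdfE ?gt_eqF//.
rewrite /normal_fun /normal_peak subr0 expr1n mul1r.
rewrite -mulrnAr sqrtrM ?sqr_ge0// sqrtr_sqr gtr0_norm//.
have -> : (- (s * x) ^+ 2 / (s ^+ 2 *+ 2) = - x ^+ 2 / 2)%R.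
  by rewrite -mulr_natr; field; rewrite gt_eqF.
by rewrite invfM [RHS]mulrC !mulrA mulfV ?mul1r// gt_eqF.
Qed.

Lemma normal_probN f : measurable_fun setT f -> (forall x, 0 <= f x) ->
  \int[N]_z f (- z)%R = \int[N]_z f z.
Proof.
move=> mf f0.
have mfN : measurable_fun setT (fun z : R => f (- z)%R).
  by apply: measurableT_comp => //; exact: measurable_oppr.
apply: (etrans (ge0_integral_normal_prob 0%R 1%R mfN (fun z => f0 _))).
apply/esym/(etrans (ge0_integral_normal_prob 0%R 1%R mf f0)).
pose g z := f z * (phi z)%:E.
have mg : measurable_fun setT g.
  apply: emeasurable_funM => //; apply/measurable_EFinP.
  exact: measurable_normal_pdf.
have g0 z : 0 <= g z by rewrite mule_ge0// lee_fin normal_pdf_ge0.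
apply/esym; apply: etrans (ge0_integral_oppr mg g0).
by apply: eq_integral => x _; rewrite /g normal_pdf01N.
Qed.

(* Completing the square: with c^2 = a^2 + b^2, the quadratic form
   x^2 + ((c z - a x) / b)^2 is symmetric in x and z. *)
Lemma normal_pdf01_exchange (a b c x z : R) : b != 0%R ->
  (c ^+ 2 = a ^+ 2 + b ^+ 2)%R ->
  (phi (- (a / b) * x + (c / b) * z) * phi x =
   phi (- (a / b) * z + (c / b) * x) * phi z)%R.
Proof.
move=> b0 cE; rewrite !normal_pdf01E.
rewrite mulrACA [RHS]mulrACA -!expRD; congr (_ * expR _)%R.
have E (u v : R) : ((- (a / b) * u + c / b * v) ^+ 2 =
    - 2 * a * c * u * v / b ^+ 2 + v ^+ 2 + a ^+ 2 / b ^+ 2 * (u ^+ 2 + v ^+ 2))%R.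
  transitivity ((a ^+ 2 * u ^+ 2 - 2 * a * c * u * v + c ^+ 2 * v ^+ 2) / b ^+ 2)%R.
    by field.
  by rewrite cE; field.
by rewrite !E; field.
Qed.

Let mphi : measurable_fun setT phi := measurable_normal_pdf 0 1.

(** For fixed x, the variable z with c z = a x + b y replaces y. The exchange identity then isolates
    the density of z, and the remaining integral over x is that of a Gaussian density up to an
    affine change of variable, hence 1. *)
Lemma normal_prob_add_pos (a b : R) f : (0 < b)%R ->
  measurable_fun setT f -> (forall x, 0 <= f x) ->
  \int[N]_x \int[N]_y f (a * x + b * y)%R =
  \int[N]_z f (Num.sqrt (a ^+ 2 + b ^+ 2) * z)%R.
Proof.
move=> b0 mf f0; set c := Num.sqrt _.
have cE : (c ^+ 2 = a ^+ 2 + b ^+ 2)%R by rewrite sqr_sqrtr// addr_ge0 ?sqr_ge0.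
have c0 : (0 < c)%R by rewrite sqrtr_gt0 ltr_wpDl ?sqr_ge0// exprn_gt0.
have phi0 x : (0 <= phi x)%R by exact: normal_pdf_ge0.
have mab : measurable_fun setT (fun z : R * R => f (a * z.1 + b * z.2)%R).
  apply: measurableT_comp => //; apply: measurable_funD; apply: measurable_funM => //.
have mfc : measurable_fun setT (fun z => f (c * z)%R).
  by apply: measurableT_comp => //; apply: measurable_funM.
rewrite ge0_integral_normal_prob; last 2 first.
- exact: (@measurable_fun_fubini_tonelli_F _ _ _ _ _ N _ mab).
- by move=> x; apply: integral_ge0.
transitivity (\int[mu]_x \int[mu]_z
    (f (c * z)%R * (phi (- (a / b) * z + c / b * x) * phi z * (c / b))%:E)).
  apply: eq_integral => x _.
  have mx : measurable_fun setT (fun y => f (a * x + b * y)%R).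
    by apply: measurableT_comp => //; apply: measurable_funD => //; exact: measurable_funM.
  rewrite ge0_integral_normal_prob// -ge0_integralZr//; last 3 first.
  - apply: emeasurable_funM => //; exact/measurable_EFinP.
  - by move=> y _; rewrite mule_ge0// lee_fin.
  - by rewrite lee_fin.
  (* This is y = (c z - a x) / b, with Jacobian c / b. *)
  rewrite -(@ge0_integral_affine _ (- (a / b) * x)%R (c / b)%R (fun y =>
      f (a * x + b * y)%R * (phi y)%:E * (phi x)%:E)) ?divr_gt0//; last 2 first.
  - do 2 (apply: emeasurable_funM => //); exact/measurable_EFinP.
  - by move=> y; rewrite !mule_ge0// lee_fin.
  apply: eq_integral => z _; rewrite -!muleA -!EFinM !mulrA; congr (f _ * _%:E).
    by field; rewrite gt_eqF.
  by congr *%R; rewrite normal_pdf01_exchange// gt_eqF.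
pose K (u : R * R) := f (c * u.2)%R *
   (phi (- (a / b) * u.2 + c / b * u.1) * phi u.2 * (c / b))%:E.
have mK : measurable_fun setT K.
  apply: emeasurable_funM; first exact: (measurableT_comp mfc).
  apply/measurable_EFinP; apply: measurable_funM => //; apply: measurable_funM.
    by apply: measurableT_comp => //; apply: measurable_funD; apply: measurable_funM.
  exact: measurableT_comp.
have K0 u : 0 <= K u.
  apply: mule_ge0 => //; rewrite lee_fin; apply: mulr_ge0; first exact: mulr_ge0.
  by rewrite divr_ge0 ?ltW.
apply: (etrans (@fubini_tonelli _ _ _ _ _ mu mu K mK K0)); rewrite /K/=.
apply: esym; apply: (etrans (ge0_integral_normal_prob 0%R 1%R mfc (fun z => f0 _))).
apply: eq_integral => z _; apply: esym.
transitivity (\int[mu]_x ((f (c * z)%R * (phi z)%:E) *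
    ((phi (- (a / b) * z + c / b * x))%:E * (c / b)%:E))).
  apply: eq_integral => x _; rewrite -!muleA -!EFinM; congr (_ * _%:E).
  by rewrite -mulrA mulrCA.
rewrite ge0_integralZl//; last 3 first.
- apply: emeasurable_funM => //; apply/measurable_EFinP.
  by apply: measurableT_comp => //; apply: measurable_funD => //; apply: measurable_funM.
- by move=> x _; rewrite mule_ge0// lee_fin// divr_ge0 ?ltW.
- by rewrite mule_ge0// lee_fin.
rewrite (@ge0_integral_affine _ _ _ (fun x => (phi x)%:E)) ?divr_gt0//.
- by rewrite integral_normal_pdf mule1.
- exact/measurable_EFinP.
Qed.

(** In the network, [b] is a multiple of an activation and may have any sign: symmetry of the normal
    law handles b < 0, and for b = 0 the root of a^2 is [a] because a >= 0. *)
Lemma normal_prob_add (a b : R) f : (0 <= a)%R ->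
  measurable_fun setT f -> (forall x, 0 <= f x) ->
  \int[N]_x \int[N]_y f (a * x + b * y)%R =
  \int[N]_z f (Num.sqrt (a ^+ 2 + b ^+ 2) * z)%R.
Proof.
move=> a0 mf f0; have [b0|b0|->] := ltgtP b 0%R.
- have b0' : (0 < - b)%R by rewrite oppr_gt0.
  rewrite -(sqrrN b); apply: etrans (normal_prob_add_pos a b0' mf f0).
  apply: eq_integral => x _.
  have mx : measurable_fun setT (fun y => f (a * x + b * y)%R).
    by apply: measurableT_comp => //; apply: measurable_funD => //; apply: measurable_funM.
  apply: (etrans (esym (normal_probN mx (fun y => f0 _)))).
  by apply: eq_integral => y _; rewrite mulrN mulNr.
- exact: normal_prob_add_pos.
- rewrite expr0n addr0 sqrtr_sqr ger0_norm//; apply: eq_integral => x _.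
  under eq_integral do rewrite mul0r addr0.
  exact: integral_normal_prob_cst.
Qed.

End gaussian.

(** * Gamma integrals *)

Section gamma.
Context {R : realType}.
Local Notation mu := (@lebesgue_measure R).
Local Open Scope ereal_scope.
Implicit Types (a b : R) (f : R -> \bar R).

(** Extended by 0 to the whole line so that affine substitutions and Tonelli apply with no domain to
    track. *)
Definition gamma_fun a (t : R) : R :=
  if (0 < t)%R then (t `^ (a - 1) * expR (- t))%R else 0%R.

(** Left unnormalised and extended-valued, because finiteness of the total mass is established only
    after the convolution formula. *)
Definition gamma_integral a f := \int[mu]_t (f t * (gamma_fun a t)%:E).

Lemma gamma_fun_ge0 a t : (0 <= gamma_fun a t)%R.
Proof. by rewrite /gamma_fun; case: ifP => // _; rewrite mulr_ge0 ?powR_ge0 ?expR_ge0. Qed.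

Lemma measurable_gamma_fun a : measurable_fun setT (gamma_fun a).
Proof.
apply: measurable_fun_ifT => //.
- exact: measurable_fun_ltr.
- apply: measurable_funM; first exact: measurable_powR.
  by apply: measurableT_comp => //; exact: measurable_oppr.
Qed.

Lemma gamma_integralE a f :
  gamma_integral a f =
  \int[mu]_(t in `]0%R, +oo[) (f t * (t `^ (a - 1) * expR (- t))%:E).
Proof.
rewrite [RHS]integral_mkcond; apply: eq_integral => t _.
rewrite patchE mem_setE in_itv/= andbT /gamma_fun; case: ifP => //.
by rewrite mule0.
Qed.

Lemma gamma_integral_ge0 a f : (forall t, 0 <= f t) -> 0 <= gamma_integral a f.
Proof.
by move=> f0; apply: integral_ge0 => t _; rewrite mule_ge0// lee_fin gamma_fun_ge0.
Qed.

Lemma gamma_integralD a f g : measurable_fun setT f -> measurable_fun setT g ->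
  (forall t, 0 <= f t) -> (forall t, 0 <= g t) ->
  gamma_integral a (fun t => f t + g t) = gamma_integral a f + gamma_integral a g.
Proof.
move=> mf mg f0 g0; rewrite /gamma_integral -ge0_integralD//.
- by apply: eq_integral => t _; rewrite ge0_muleDl.
- by move=> t _; rewrite mule_ge0// lee_fin gamma_fun_ge0.
- by apply: emeasurable_funM => //; apply/measurable_EFinP; exact: measurable_gamma_fun.
- by move=> t _; rewrite mule_ge0// lee_fin gamma_fun_ge0.
- by apply: emeasurable_funM => //; apply/measurable_EFinP; exact: measurable_gamma_fun.
Qed.

Lemma gamma_integralZ a (k : \bar R) f : 0 <= k ->
  measurable_fun setT f -> (forall t, 0 <= f t) ->
  gamma_integral a (fun t => k * f t) = k * gamma_integral a f.
Proof.
move=> k0 mf f0; rewrite /gamma_integral -ge0_integralZl//.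
- by apply: eq_integral => t _; rewrite muleA.
- by apply: emeasurable_funM => //; apply/measurable_EFinP; exact: measurable_gamma_fun.
- by move=> t _; rewrite mule_ge0// lee_fin gamma_fun_ge0.
Qed.

Lemma measurable_gamma_integral d (T : measurableType d) a (h : T * R -> \bar R) :
  measurable_fun setT h -> (forall u, 0 <= h u) ->
  measurable_fun setT (fun x => gamma_integral a (fun t => h (x, t))).
Proof.
move=> mh h0.
pose k (u : T * R) := h u * (gamma_fun a u.2)%:E.
have mk : measurable_fun setT k.
  apply: emeasurable_funM => //; apply/measurable_EFinP.
  by apply: measurableT_comp => //; exact: measurable_gamma_fun.
have k0 u : 0 <= k u by rewrite mule_ge0// lee_fin gamma_fun_ge0.
exact: (@measurable_fun_fubini_tonelli_F _ _ _ _ _ mu k mk k0).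
Qed.

Definition beta_density a b (w : R) : R :=
  if (0 < w < 1)%R then (w `^ (a - 1) * (1 - w) `^ (b - 1))%R else 0%R.

Lemma beta_density_ge0 a b w : (0 <= beta_density a b w)%R.
Proof. by rewrite /beta_density; case: ifP => // _; rewrite mulr_ge0 ?powR_ge0. Qed.

Lemma measurable_beta_density a b : measurable_fun setT (beta_density a b).
Proof.
apply: measurable_fun_ifT => //.
- apply: measurable_and; apply: measurable_fun_ltr => //.
- apply: measurable_funM; first exact: measurable_powR.
  apply: (measurableT_comp (measurable_powR _)).
  exact: measurable_funB.
Qed.

(** In the coordinates u = t w, v = t (1 - w), whose Jacobian is t, the product of two Gamma
    integrands separates into a function of t and one of w. *)
Lemma gamma_fun_conv a b t w : (0 < t)%R ->
  (gamma_fun b (t - t * w) * gamma_fun a (t * w) * t =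
   gamma_fun (a + b) t * beta_density a b w)%R.
Proof.
move=> t0; rewrite /gamma_fun /beta_density t0.
have -> : (0 < t - t * w)%R = (w < 1)%R.
  by rewrite subr_gt0 -{2}[t]mulr1 ltr_pM2l.
rewrite pmulr_rgt0//.
case: (ltP w 1%R) => w1; last by rewrite andbF !mul0r mulr0.
case: (ltP 0%R w) => w0 /=; last by rewrite mulr0 mul0r mulr0.
have -> : (t - t * w = t * (1 - w))%R by ring.
rewrite !powRM ?subr_ge0 ?(ltW w1) ?(ltW w0) ?(ltW t0)//.
have -> : (t `^ (a + b - 1) = t `^ (a - 1) * t `^ (b - 1) * t)%R.
  have -> : (a + b - 1 = (a - 1) + (b - 1) + 1)%R by ring.
  by rewrite !powRD ?(gt_eqF t0) ?implybT// powRr1// ltW.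
have -> : (expR (- t) = expR (- (t * (1 - w))) * expR (- (t * w)))%R.
  by rewrite -expRD; congr expR; ring.
ring.
Qed.

Lemma gamma_integral_conv a b f : measurable_fun setT f -> (forall t, 0 <= f t) ->
  gamma_integral a (fun u => gamma_integral b (fun v => f (u + v)%R)) =
  (\int[mu]_w (beta_density a b w)%:E) * gamma_integral (a + b) f.
Proof.
move=> mf f0; set B := (X in _ = X * _).
have ga0 c t : 0 <= (gamma_fun c t)%:E :> \bar R by rewrite lee_fin gamma_fun_ge0.
have mga c : measurable_fun setT (fun t => (gamma_fun c t)%:E).
  by apply/measurable_EFinP; exact: measurable_gamma_fun.
have B0 : 0 <= B by apply: integral_ge0 => w _; rewrite lee_fin beta_density_ge0.
pose K (u : R * R) := f u.2 * ((gamma_fun b (u.2 - u.1))%:E * (gamma_fun a u.1)%:E).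
have mK : measurable_fun setT K.
  apply: emeasurable_funM; first exact: measurableT_comp.
  apply: emeasurable_funM.
    by apply: (measurableT_comp (mga b)); exact: measurable_funB.
  exact: (measurableT_comp (mga a)).
have K0 u : 0 <= K u by rewrite mule_ge0// mule_ge0.
transitivity (\int[mu]_u \int[mu]_t K (u, t)).
  apply: eq_integral => u _.
  pose h v := f (u + v)%R * (gamma_fun b v)%:E.
  have mh : measurable_fun setT h.
    by apply: emeasurable_funM => //; apply: measurableT_comp => //; exact: measurable_funD.
  have h0 v : 0 <= h v by rewrite mule_ge0.
  rewrite /gamma_integral -/h muleC.
  (* The translation v = t - u makes the sum t the inner variable, ready to be exchanged with u. *)
  rewrite -(ge0_integral_affine (- u)%R ltr01 mh h0).
  rewrite -ge0_integralZl//=.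
  - apply: eq_integral => t _; rewrite mule1 mul1r /h /K/= muleC -muleA.
    by rewrite addNKr [(- u + t)%R]addrC.
  - under eq_fun do rewrite mule1 mul1r; apply: (measurableT_comp mh).
    exact: measurable_funD.
  - by move=> t _; rewrite mule1 h0.
apply: (etrans (@fubini_tonelli _ _ _ _ _ mu mu K mK K0)).
rewrite muleC /gamma_integral -ge0_integralZr//; last 2 first.
- exact: (emeasurable_funM mf (mga _)).
- by move=> t _; rewrite mule_ge0.
apply: eq_integral => t _; rewrite -muleA /K/=.
rewrite ge0_integralZl//; last 2 first.
- apply: emeasurable_funM; last exact: mga.
  by apply: (measurableT_comp (mga b)); exact: measurable_funB.
- by move=> u _; rewrite mule_ge0.
(* For t <= 0 both sides vanish, since u and t - u cannot both be positive. For t > 0 the scaling u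
   = t w is legitimate. *)
congr *%E; have [t0|t0] := ltP 0%R t; last first.
  rewrite [X in _ = X * _](_ : _ = 0) ?mul0e; last first.
    by rewrite /gamma_fun ltNge t0.
  apply: integral0_eq => u _; rewrite /gamma_fun.
  case: (ltP 0%R u) => u0; last by rewrite mule0.
  by rewrite subr_gt0 ltNge (le_trans t0 (ltW u0)) mul0e.
pose h u := (gamma_fun b (t - u))%:E * (gamma_fun a u)%:E.
have mh : measurable_fun setT h.
  apply: emeasurable_funM => //.
  by apply: (measurableT_comp (mga b)); exact: measurable_funB.
have h0 u : 0 <= h u by rewrite mule_ge0.
rewrite -/h; apply: (etrans (esym (ge0_integral_affine 0%R t0 mh h0))).
rewrite /B -ge0_integralZl//; last 2 first.
- by apply/measurable_EFinP; exact: measurable_beta_density.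
- by move=> w _; rewrite lee_fin beta_density_ge0.
apply: eq_integral => w _.
by rewrite /h add0r -!EFinM gamma_fun_conv.
Qed.

End gamma.

Lemma powRVl {R : realType} (x r : R) : 0 <= x -> x^-1 `^ r = x `^ (- r).
Proof. by move=> x0; rewrite -powR_inv1// -powRrM mulN1r. Qed.

(** * Finiteness, positivity and normalisation of Gamma integrals *)

Section gamma_normalisation.
Context {R : realType}.
Local Notation mu := (@lebesgue_measure R).
Local Notation N := (@normal_prob R 0 1).
Local Notation phi := (@normal_pdf R 0 1).
Local Open Scope ereal_scope.
Implicit Types (a b : R) (f : R -> \bar R).

Let mphi : measurable_fun setT phi := measurable_normal_pdf 0 1.
Let phi0 x : (0 <= phi x)%R := normal_pdf_ge0 0 1 x.

Lemma normal_prob_relu_split f : measurable_fun setT f -> (forall t, 0 <= f t) ->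
  \int[N]_z f (relu z) =
  \int[mu]_(z in `]-oo, 0%R]) (f 0%R * (phi z)%:E) +
  \int[mu]_(z in `]0%R, +oo[) (f z * (phi z)%:E).
Proof.
move=> mf f0.
have mr : measurable_fun setT (fun z : R => f (relu z)).
  by apply: measurableT_comp => //; exact: measurable_maxr.
apply: (etrans (ge0_integral_normal_prob 0%R 1%R mr (fun z => f0 _))).
have -> : [set: measurableTypeR R] = `]-oo, 0%R] `|` `]0%R, +oo[.
  by rewrite -itv_bndbnd_setU// set_itvNyy.
rewrite ge0_integral_setU//; first last.
- apply/disj_set2P; apply/seteqP; split => // x [] /=; rewrite !in_itv/= andbT.
  by move=> x0; rewrite ltNge x0.
- by move=> z _; rewrite mule_ge0// lee_fin.
- apply: measurable_funTS; apply: emeasurable_funM => //.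
  exact/measurable_EFinP.
congr +%E; apply: eq_integral => z; rewrite mem_setE in_itv/= ?andbT => z0.
  by rewrite /relu (max_idPr z0).
by rewrite /relu (max_idPl (ltW z0)).
Qed.

Lemma normal_half :
  \int[mu]_(z in `]-oo, 0%R]) (phi z)%:E = (2^-1)%:E /\
  \int[mu]_(z in `]0%R, +oo[) (phi z)%:E = (2^-1)%:E.
Proof.
have mE : measurable_fun setT (fun z => (phi z)%:E) by exact/measurable_EFinP.
have E0 (z : R) : 0 <= (phi z)%:E by rewrite lee_fin.
have e : \int[mu]_(z in `]0%R, +oo[) (phi z)%:E =
         \int[mu]_(z in `]-oo, 0%R]) (phi z)%:E.
  rewrite integral_itv_obnd_cbnd; last exact: measurable_funTS.
  apply: (etrans (ge0_integration_by_substitution0 mE E0)).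
  by apply: eq_integral => z _; rewrite normal_pdf01N.
(* The two halves have equal mass by symmetry; +oo must be excluded before 1 = x + x can be
   solved. *)
have aux (x y : \bar R) : 0 <= x -> y = x -> 1 = x + y ->
    x = (2^-1)%:E /\ y = (2^-1)%:E.
  move=> x0 ->; case: x x0 => [r _|_|//]; last by rewrite addye.
  by rewrite -EFinD => -[] h; split; congr EFin; lra.
have h : 1 = \int[mu]_(z in `]-oo, 0%R]) (phi z)%:E +
           \int[mu]_(z in `]0%R, +oo[) (phi z)%:E.
  apply: (etrans (etrans (esym (integral_normal_prob_cst 0%R 1%R 1))
    (@normal_prob_relu_split (cst 1) (measurable_cst _) (fun=> lee01)))).
  by congr +%E; apply: eq_integral => z _; exact: mul1e.
by apply: aux => //; exact: integral_ge0.
Qed.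

(** The Gaussian peak times the factor 2^(-1/2) of dx = (2 t)^(-1/2) dt, where t = x^2 / 2. *)
Let c0 : R := (normal_peak 1 * 2 `^ (- 2^-1))%R.

Lemma normal_prob_sqr_relu_unnormalised f : measurable_fun setT f -> (forall t, 0 <= f t) ->
  \int[N]_z f (relu z ^+ 2 / 2)%R =
  (2^-1)%:E * f 0%R + c0%:E * gamma_integral 2^-1 f.
Proof.
move=> mf f0; have [h1 h2] := normal_half.
have c00 : (0 <= c0)%R by rewrite mulr_ge0 ?normal_peak_ge0 ?powR_ge0.
have mg : measurable_fun setT (fun z : R => f (z ^+ 2 / 2)%R).
  by apply: measurableT_comp => //; apply: measurable_funM.
apply: (etrans (normal_prob_relu_split mg (fun z => f0 _))); congr +%E.
  rewrite expr0n/= mul0r ge0_integralZl//.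
  - by rewrite h1 muleC.
  - by apply: measurable_funTS; exact/measurable_EFinP.
  - by move=> z _; rewrite lee_fin.
rewrite gamma_integralE -ge0_integralZl//; last 2 first.
- apply: measurable_funTS; apply: emeasurable_funM => //; apply/measurable_EFinP.
  apply: measurable_funM; first exact: measurable_powR.
  by apply: measurableT_comp => //; exact: measurable_oppr.
- by move=> t _; rewrite mule_ge0// lee_fin mulr_ge0 ?powR_ge0 ?expR_ge0.
pose F t := c0%:E * (f t * (t `^ (2^-1 - 1) * expR (- t))%:E).
have mF : measurable_fun setT F.
  apply: measurable_funeM; apply: emeasurable_funM => //; apply/measurable_EFinP.
  apply: measurable_funM; first exact: measurable_powR.
  by apply: measurableT_comp => //; exact: measurable_oppr.
have F0 t : 0 <= F t.
  by rewrite mule_ge0 ?lee_fin// mule_ge0// lee_fin mulr_ge0 ?powR_ge0 ?expR_ge0.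
apply: etrans (ge0_integral_half_sqr mF F0).
apply: eq_integral => x; rewrite mem_setE in_itv/= andbT => x0.
rewrite /F muleCA -muleA; congr *%E; rewrite -!EFinM; congr EFin.
rewrite normal_pdf01E /c0.
have -> : ((x ^+ 2 / 2) `^ (2^-1 - 1) = 2 `^ (2^-1) / x :> R)%R.
  have -> : (2^-1 - 1 = - 2^-1 :> R)%R by field.
  rewrite powRN powRM ?sqr_ge0 ?invr_ge0// -powR_mulrn ?(ltW x0)//.
  by rewrite -powRrM mulfV// powRr1 ?(ltW x0)// powRVl// powRN invfM invrK mulrC.
have -> : (2 `^ (- 2^-1) = (2 `^ (2^-1))^-1 :> R)%R by rewrite powRN.
have s2 : (2 `^ (2^-1) != 0 :> R)%R by rewrite gt_eqF// powR_gt0.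
by rewrite mulNr; field; rewrite s2 gt_eqF.
Qed.

(** The logarithm lies below its tangent at k, so y ln t <= y ln k + y t / k - y. The choice k = 2 y
    + 1 is positive even for y = 0 and makes y / k at most 1/2. *)
Lemma powR_le_expR (y t : R) : (0 <= y)%R -> (0 < t)%R ->
  (t `^ y <= expR (y * ln (2 * y + 1)) * expR (t / 2))%R.
Proof.
move=> y0 t0; rewrite /powR gt_eqF// -expRD ler_expR.
set k := (2 * y + 1)%R; have k0 : (0 < k)%R by rewrite /k; lra.
have : (ln t <= ln k + t / k - 1)%R.
  have -> : (t = k * (1 + (t / k - 1)))%R by field; rewrite gt_eqF.
  have tk : (-1 < t / k - 1)%R by rewrite ltrBrDr addNr divr_gt0.
  rewrite lnM ?posrE//; last by rewrite addrCA subrr addr0 divr_gt0.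
  have := @le_ln1Dx _ _ tk.
  have -> : (k * (1 + (t / k - 1)) / k = t / k)%R by field; rewrite gt_eqF.
  by lra.
move=> /(ler_wpM2l y0)/le_trans; apply.
have : (y * (t / k) <= t / 2)%R.
  rewrite mulrCA ler_wpM2l ?(ltW t0)// ler_pdivrMr// /k; lra.
nra.
Qed.

Lemma gamma_integral_cst a (k : \bar R) : 0 <= k ->
  gamma_integral a (cst k) = k * gamma_integral a (cst 1).
Proof.
move=> k0; rewrite -gamma_integralZ//.
by apply: eq_integral => t _; rewrite mule1.
Qed.

(** With f = 1 the preceding decomposition reads 1 = 1/2 + [c0] times this mass, and [c0] is
    positive. *)
Lemma gamma_integral_half_lty : gamma_integral (2^-1 : R) (cst 1) < +oo.
Proof.
have := etrans (esym (integral_normal_prob_cst 0%R 1%R 1))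
  (@normal_prob_sqr_relu_unnormalised (cst 1) (measurable_cst _) (fun=> lee01)).
rewrite /= mule1.
have c00 : (0 < c0)%R by rewrite mulr_gt0 ?normal_peak_gt0 ?oner_eq0 ?powR_gt0.
have : 0 <= gamma_integral (2^-1 : R) (cst 1) by exact: gamma_integral_ge0.
case: (gamma_integral _ _) => [r _ _|_|//]; first by rewrite ltry.
by rewrite gt0_muley ?lte_fin// addey.
Qed.

Lemma gamma_integral1_lty a : (2^-1 <= a)%R -> gamma_integral a (cst 1) < +oo.
Proof.
move=> a2; pose y := (a - 2^-1)%R; have y0 : (0 <= y)%R by rewrite subr_ge0.
(* The exponential is the constant of [powR_le_expR], and 2^(-1/2) cancels the factor 2^(1/2) of
   (t/2)^(-1/2). The 2 in front of [C] below offsets the Jacobian 1/2, so half of the decay e^(-t)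
   absorbs t^y and the case 1/2, rescaled, dominates. *)
pose C := (expR (y * ln (2 * y + 1)) * 2 `^ (- 2^-1) : R)%R.
have C0 : (0 <= C)%R by rewrite mulr_ge0 ?expR_ge0 ?powR_ge0.
have mg : measurable_fun setT (fun t : R => (gamma_fun 2^-1 t)%:E).
  by apply/measurable_EFinP; exact: measurable_gamma_fun.
have g0 (t : R) : 0 <= (gamma_fun 2^-1 t)%:E by rewrite lee_fin gamma_fun_ge0.
have h2 : (0 < 2^-1 :> R)%R by rewrite invr_gt0.
have mg2 : measurable_fun setT (fun t : R => (gamma_fun 2^-1 (0 + 2^-1 * t))%:E * (2^-1)%:E).
  apply: emeasurable_funM => //; apply: (measurableT_comp mg).
  by apply: measurable_funD => //; apply: measurable_funM.
apply: (@le_lt_trans _ _ (\int[mu]_t ((2 * C)%:E *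
    ((gamma_fun 2^-1 (0 + 2^-1 * t))%:E * (2^-1)%:E)))); last first.
  rewrite ge0_integralZl//; last 2 first.
  - by move=> t _; rewrite mule_ge0// lee_fin ltW.
  - by rewrite lee_fin mulr_ge0.
  rewrite (ge0_integral_affine 0%R h2 mg g0).
  rewrite lte_mul_pinfty ?lee_fin ?mulr_ge0//.
  have := gamma_integral_half_lty; rewrite /gamma_integral.
  by under eq_integral do rewrite mul1e.
apply: ge0_le_integral => //.
- by move=> t _; rewrite mul1e lee_fin gamma_fun_ge0.
- by apply: emeasurable_funM => //; apply/measurable_EFinP; exact: measurable_gamma_fun.
- exact: measurable_funeM.
move=> t _; rewrite mul1e -!EFinM lee_fin add0r /gamma_fun.
rewrite pmulr_rgt0//; case: ifPn => t0; last by rewrite mul0r mulr0.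
have -> : (a - 1 = y + (2^-1 - 1))%R by rewrite /y; ring.
rewrite powRD ?(gt_eqF t0) ?implybT// powRM ?(ltW t0) ?invr_ge0//.
have -> : (2^-1 `^ (2^-1 - 1) = 2 `^ (2^-1) :> R)%R.
  by rewrite powRVl//; congr powR; field.
have -> : (expR (- t) = expR (- (2^-1 * t)) * (expR (t / 2))^-1)%R.
  by rewrite -expRN -expRD; congr expR; field.
have := powR_le_expR y0 t0.
rewrite /C powRN.
set X := powR t y; set E := expR (y * _); set e2 := expR (t / 2).
set Z := expR _; set s2 := powR 2 _; set P := powR t _ => XE.
have s20 : (s2 != 0)%R by rewrite gt_eqF// powR_gt0.
have e20 : (0 < e2)%R by exact: expR_gt0.
have -> : (2 * (E / s2) * (s2 * P * Z / 2) = E * P * Z)%R by field.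
have -> : (X * P * (Z / e2) = X / e2 * (P * Z))%R by field; rewrite gt_eqF.
rewrite -(mulrA E) ler_wpM2r ?mulr_ge0 ?powR_ge0 ?expR_ge0//.
by rewrite ler_pdivrMr.
Qed.

Lemma gamma_integral1_gt0 a : (0 <= a)%R -> 0 < gamma_integral a (cst 1).
Proof.
move=> a0.
(* On ]1, 2] one has t^(a-1) >= t^(-1) >= 1/2 and e^(-t) >= e^(-2). *)
apply: (@lt_le_trans _ _ (\int[mu]_(t in `]1%R, 2%R]) (2^-1 * expR (- 2))%:E)).
  rewrite integral_cst//= lebesgue_measure_itv/= lte_fin ltr1n -EFinB -EFinM.
  by rewrite lte_fin !mulr_gt0 ?invr_gt0 ?expR_gt0// subr_gt0 ltr1n.
rewrite integral_mkcond; apply: ge0_le_integral => //.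
- by move=> t _; apply: erestrict_ge0 => // x _; rewrite lee_fin mulr_ge0 ?expR_ge0.
- by apply/(measurable_restrictT _ _).1.
- by apply: emeasurable_funM => //; apply/measurable_EFinP; exact: measurable_gamma_fun.
move=> t _; rewrite patchE mul1e; case: ifPn => [|_]; last by rewrite lee_fin gamma_fun_ge0.
rewrite mem_setE in_itv/= => /andP[t1 t2]; rewrite lee_fin /gamma_fun.
have t0 : (0 < t)%R by exact: lt_trans ltr01 t1.
rewrite t0 ler_pM ?invr_ge0 ?expR_ge0//; last by rewrite ler_expR lerN2.
apply: (@le_trans _ _ (t `^ (-1))%R).
  by rewrite powR_inv1 ?(ltW t0)// lef_pV2 ?posrE.
by apply: ler_powR; [exact: ltW|rewrite lerBrDr addNr].
Qed.

(** [Gamma] takes [fine] of an extended integral; finiteness makes this lossless. The range a >= 1/2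
    covers every n/2 and n/2 + s/2 with n >= 1 and s > 0. *)
Lemma GammaE a : (2^-1 <= a)%R -> gamma_integral a (cst 1) = (Gamma a)%:E.
Proof.
move=> a2; rewrite /Gamma fineK.
  rewrite gamma_integralE; apply: eq_integral => t _.
  by rewrite mul1e.
rewrite (_ : integral _ _ _ = gamma_integral a (cst 1)); last first.
  by rewrite gamma_integralE; apply: eq_integral => t _; rewrite mul1e.
by rewrite ge0_fin_numE ?gamma_integral1_lty// gamma_integral_ge0.
Qed.

Lemma Gamma_gt0 a : (2^-1 <= a)%R -> (0 < Gamma a)%R.
Proof.
move=> a2; rewrite -lte_fin -GammaE// gamma_integral1_gt0//.
by apply: le_trans a2; rewrite invr_ge0.
Qed.

Lemma normal_prob_sqr_relu f : measurable_fun setT f -> (forall t, 0 <= f t) ->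
  \int[N]_z f (relu z ^+ 2 / 2)%R =
  (2^-1)%:E * f 0%R + (2^-1 / Gamma 2^-1)%:E * gamma_integral 2^-1 f.
Proof.
move=> mf f0; rewrite normal_prob_sqr_relu_unnormalised//; congr (_ + _%:E * _).
(* Total mass: 1 = 1/2 + [c0] Gamma(1/2), which determines [c0]. *)
have := etrans (esym (integral_normal_prob_cst 0%R 1%R 1))
  (@normal_prob_sqr_relu_unnormalised (cst 1) (measurable_cst _) (fun=> lee01)).
rewrite /= mule1.
rewrite GammaE// -EFinM -EFinD => -[] h.
have G0 : (Gamma (2^-1 : R) != 0)%R by rewrite gt_eqF// Gamma_gt0.
by apply: (mulIf G0); rewrite divfK//; lra.
Qed.

(** The convolution formula with f = 1 equates Gamma(a) Gamma(b) with the Beta integral times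
    Gamma(a + b); as Gamma(a + b) > 0, the Beta integral cannot be infinite. *)
Lemma beta_Gamma a b : (2^-1 <= a)%R -> (2^-1 <= b)%R ->
  \int[mu]_w (beta_density a b w)%:E = (Gamma a * Gamma b / Gamma (a + b))%:E.
Proof.
move=> a2 b2.
have ab2 : (2^-1 <= a + b)%R by rewrite (le_trans a2)// lerDl (le_trans _ b2)// invr_ge0.
have := @gamma_integral_conv _ a b (cst 1) (measurable_cst _) (fun=> lee01).
rewrite (_ : (fun u => _) = cst (Gamma b)%:E); last first.
  by apply/funext => u; rewrite -GammaE.
rewrite gamma_integral_cst ?lee_fin ?ltW ?Gamma_gt0// !GammaE// -EFinM.
set B := integral _ _ _.
have : 0 <= B by apply: integral_ge0 => w _; rewrite lee_fin beta_density_ge0.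
have G0 := Gamma_gt0 ab2.
case: B => [r|//|//] _; last by rewrite gt0_mulye ?lte_fin.
rewrite -EFinM => -[] h; congr EFin; move: G0 h => /lt0r_neq0.
move: (Gamma a) (Gamma b) (Gamma (a + b)) => x y z z0 h.
by apply: (mulIf z0); rewrite -h divfK// mulrC.
Qed.

End gamma_normalisation.

(** * Gamma laws of order n/2 and their convolution *)

Section gamma_mean.
Context {R : realType}.
Local Open Scope ereal_scope.
Implicit Types (f g : R -> \bar R) (n : nat).

(* The integral of f against the Gamma(n / 2) law, the Dirac mass at 0 when n = 0. *)
Definition gamma_mean n f : \bar R :=
  if n is 0%N then f 0%R
  else (Gamma (n%:R / 2))^-1%:E * gamma_integral (n%:R / 2) f.

Lemma half_le_natr n : (0 < n)%N -> (2^-1 <= n%:R / 2 :> R)%R.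
Proof. by move=> n0; rewrite ler_pdivlMr// mulVf// ler1n. Qed.

Lemma eq_gamma_mean n f g : f =1 g -> gamma_mean n f = gamma_mean n g.
Proof. by move/funext ->. Qed.

Let GammaV_ge0 n : (0 <= (Gamma (n.+1%:R / 2 : R))^-1)%R.
Proof. by rewrite invr_ge0 ltW// Gamma_gt0// half_le_natr. Qed.

Lemma gamma_mean_ge0 n f : (forall t, 0 <= f t) -> 0 <= gamma_mean n f.
Proof.
move=> f0; case: n => [|n] /=; first exact: f0.
by rewrite mule_ge0 ?lee_fin ?gamma_integral_ge0//; exact: GammaV_ge0.
Qed.

Lemma gamma_meanD n f g : measurable_fun setT f -> measurable_fun setT g ->
  (forall t, 0 <= f t) -> (forall t, 0 <= g t) ->
  gamma_mean n (fun t => f t + g t) = gamma_mean n f + gamma_mean n g.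
Proof.
move=> mf mg f0 g0; case: n => [//|n] /=.
by rewrite gamma_integralD// ge0_muleDr// gamma_integral_ge0.
Qed.

Lemma gamma_meanZ n (k : \bar R) f : 0 <= k ->
  measurable_fun setT f -> (forall t, 0 <= f t) ->
  gamma_mean n (fun t => k * f t) = k * gamma_mean n f.
Proof.
move=> k0 mf f0; case: n => [//|n] /=.
by rewrite gamma_integralZ// muleCA.
Qed.

Lemma gamma_mean_cst n (k : \bar R) : 0 <= k -> gamma_mean n (cst k) = k.
Proof.
case: n => [//|n] k0 /=; have n2 := half_le_natr (ltn0Sn n).
rewrite gamma_integral_cst// GammaE// muleCA -EFinM mulVf ?mule1//.
by rewrite gt_eqF// Gamma_gt0.
Qed.

Lemma le_gamma_mean n f g : measurable_fun setT f -> measurable_fun setT g ->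
  (forall t, 0 <= f t) -> (forall t, (0 <= t)%R -> f t <= g t) ->
  (forall t, 0 <= g t) -> gamma_mean n f <= gamma_mean n g.
Proof.
move=> mf mg f0 fg g0; case: n => [|n] /=; first exact: fg.
apply: lee_wpmul2l; first by rewrite lee_fin; exact: GammaV_ge0.
apply: ge0_le_integral => //.
- by move=> t _; rewrite mule_ge0// lee_fin gamma_fun_ge0.
- by apply: emeasurable_funM => //; apply/measurable_EFinP; exact: measurable_gamma_fun.
- by apply: emeasurable_funM => //; apply/measurable_EFinP; exact: measurable_gamma_fun.
move=> t _; rewrite /gamma_fun; case: ifPn => [t0|]; last by rewrite !mule0.
by rewrite lee_wpmul2r ?fg ?lee_fin ?mulr_ge0 ?powR_ge0 ?expR_ge0// ltW.
Qed.

Lemma measurable_gamma_mean d (T : measurableType d) n (h : T * R -> \bar R) :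
  measurable_fun setT h -> (forall u, 0 <= h u) ->
  measurable_fun setT (fun x => gamma_mean n (fun t => h (x, t))).
Proof.
move=> mh h0; case: n => [|n] /=; first exact: measurableT_comp.
by apply: measurable_funeM; exact: measurable_gamma_integral.
Qed.

(** The Beta constant turns the two normalisations into the one of order (n + 1) / 2; for n = 0 the
    Dirac mass is neutral for convolution. *)
Lemma gamma_meanS n f : measurable_fun setT f -> (forall t, 0 <= f t) ->
  gamma_mean n (fun u => gamma_mean 1 (fun v => f (u + v)%R)) = gamma_mean n.+1 f.
Proof.
move=> mf f0; case: n => [|n].
  by rewrite {1}/gamma_mean; apply: eq_gamma_mean => v; rewrite add0r.
have n2 := half_le_natr (ltn0Sn n); have h2 := half_le_natr (ltn0Sn 0).
have nS : (n.+1%:R / 2 + 1%:R / 2 = n.+2%:R / 2 :> R)%R.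
  by rewrite -mulrDl -natrD addn1.
rewrite /gamma_mean gamma_integralZ; last 3 first.
- by rewrite lee_fin; exact: GammaV_ge0.
- apply: (@measurable_gamma_integral _ _ _ _ (fun u : R * R => f (u.1 + u.2)%R)) => //.
  by apply: measurableT_comp => //; exact: measurable_funD.
- by move=> t; exact: gamma_integral_ge0.
rewrite gamma_integral_conv// beta_Gamma// nS !muleA -!EFinM.
have := Gamma_gt0 (half_le_natr (ltn0Sn n.+1)).
have := Gamma_gt0 n2; have := Gamma_gt0 h2.
move: (Gamma (n.+1%:R / 2)) (Gamma (1%:R / 2)) (Gamma (n.+2%:R / 2)) => x y z.
move=> /lt0r_neq0 y0 /lt0r_neq0 x0 /lt0r_neq0 z0.
by congr (_%:E * _); field; rewrite ?x0 ?y0 ?z0.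
Qed.

Lemma measurable_powR_EFin (r : R) : measurable_fun setT (fun t : R => (t `^ r)%:E).
Proof. by apply/measurable_EFinP; exact: measurable_powR. Qed.

(** The factor t^r merely shifts the order of the Gamma integrand by r. *)
Lemma gamma_mean_powR n (c r : R) : (0 <= c)%R -> (0 <= r)%R -> (0 < n)%N ->
  gamma_mean n (fun t => ((c * t) `^ r)%:E) =
  (c `^ r * (Gamma (n%:R / 2 + r) / Gamma (n%:R / 2)))%:E.
Proof.
move=> c0 r0; case: n => [//|n] _; have n2 := half_le_natr (ltn0Sn n).
rewrite /gamma_mean; set a := (n.+1%:R / 2)%R.
have ar : (2^-1 <= a + r)%R by rewrite (le_trans n2)// lerDl.
rewrite [X in _ * X](_ : _ = gamma_integral (a + r) (cst (c `^ r)%:E)); last first.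
  apply: eq_integral => t _; rewrite -!EFinM /gamma_fun; case: ifPn => [t0|_].
    rewrite powRM ?(ltW t0)// -mulrA; congr (_ * _)%:E; rewrite mulrA -powRD.
      by congr (_ `^ _ * _)%R; ring.
    by rewrite (gt_eqF t0) implybT.
  by rewrite !mulr0.
rewrite gamma_integral_cst ?lee_fin ?powR_ge0// GammaE// muleCA -!EFinM.
by rewrite [((Gamma a)^-1 * _)%R]mulrC.
Qed.

End gamma_mean.
Arguments gamma_mean : simpl never.

(** * The binomial mixture of Gamma laws produced by one layer *)

Section relu_step.
Context {R : realType}.
Variable q : R.
Hypothesis q01 : (0 < q <= 1)%R.
Local Open Scope ereal_scope.
Implicit Types (h : R -> \bar R) (n m : nat).

(** Transition operator of the running sum of squared outputs: it averages [h] after one more neuron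
    has been added to the sum x. *)
Definition relu_step (rho : R) h (x : R) : \bar R :=
  (1 - q / 2)%:E * h x + (q / 2)%:E * gamma_mean 1 (fun t => h (x + rho * t)%R).

Let p0 : (0 <= q / 2)%R. Proof. by case/andP: q01 => q0 _; rewrite divr_ge0// ltW. Qed.
Let p1 : (0 < 1 - q / 2)%R. Proof. by case/andP: q01 => q0 q1; lra. Qed.

Lemma qd_ge0 m n : (0 <= qd q m n)%R.
Proof. by rewrite /qd !mulr_ge0 ?exprn_ge0// ltW. Qed.

(** Pascal's rule. For n = m the exponent m - n.+1 is truncated, and the vanishing binomial
    coefficient removes that term. *)
Lemma qdS m n : (n <= m)%N ->
  (qd q m.+1 n.+1 = qd q m n * (q / 2) + qd q m n.+1 * (1 - q / 2))%R.
Proof.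
rewrite leq_eqVlt => /predU1P[->|nm]; rewrite /qd.
  by rewrite !binn bin_small// !subnn exprS; ring.
by rewrite binS natrD subSS -(subnSK nm) !exprS; ring.
Qed.

Lemma qd0 m : qd q m 0 = ((1 - q / 2) ^+ m)%R.
Proof. by rewrite /qd bin0 expr0 !mul1r subn0. Qed.

(** Conditions the binomial count on one further trial; nonnegativity is what allows distributing
    products over sums in the extended reals. *)
Lemma sum_qdS m (c : nat -> \bar R) : (forall n, 0 <= c n) ->
  \sum_(n < m.+1) (qd q m n)%:E * ((1 - q / 2)%:E * c n + (q / 2)%:E * c n.+1) =
  \sum_(n < m.+2) (qd q m.+1 n)%:E * c n.
Proof.
move=> c0.
have q0 n : 0 <= (qd q m n)%:E by rewrite lee_fin qd_ge0.
have pc n : 0 <= (q / 2)%:E * c n by rewrite mule_ge0// lee_fin.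
have pc' n : 0 <= (1 - q / 2)%:E * c n by rewrite mule_ge0// lee_fin ltW.
have E n : (n <= m)%N -> (qd q m.+1 n.+1)%:E * c n.+1 =
    (qd q m n)%:E * ((q / 2)%:E * c n.+1) +
    (qd q m n.+1)%:E * ((1 - q / 2)%:E * c n.+1).
  move=> nm; rewrite qdS// EFinD ge0_muleDl.
  - by rewrite !EFinM -!muleA.
  - by rewrite lee_fin mulr_ge0 ?qd_ge0.
  - by rewrite lee_fin mulr_ge0 ?qd_ge0 ?(ltW p1).
under eq_bigr do rewrite ge0_muleDr//.
rewrite big_split/= [RHS]big_ord_recl/=.
rewrite [X in _ = _ + X](eq_bigr (fun n : 'I_m.+1 =>
    (qd q m n)%:E * ((q / 2)%:E * c n.+1) +
    (qd q m n.+1)%:E * ((1 - q / 2)%:E * c n.+1))); last first.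
  by move=> n _; rewrite /bump /= add1n E// -ltnS.
rewrite big_split/= [RHS]addeCA [LHS]addeC; congr +%E.
rewrite [LHS]big_ord_recl big_ord_recr/= muleA -EFinM; congr +%E.
  by rewrite !qd0 exprS mulrC.
by rewrite [X in _ + X](_ : _ = 0) ?adde0// /qd bin_small// !mul0r mul0e.
Qed.

Lemma relu_step_ge0 rho h : (forall x, 0 <= h x) -> forall x, 0 <= relu_step rho h x.
Proof.
move=> h0 x; apply: adde_ge0; apply: mule_ge0.
- by rewrite lee_fin ltW.
- exact: h0.
- by rewrite lee_fin.
- by apply: gamma_mean_ge0 => t; exact: h0.
Qed.

Lemma measurable_affine_comp h (x rho : R) : measurable_fun setT h ->
  measurable_fun setT (fun t => h (x + rho * t)%R).
Proof.
by move=> mh; apply: measurableT_comp => //; apply: measurable_funD => //; exact: measurable_funM.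
Qed.

Lemma measurable_relu_step rho h : measurable_fun setT h -> (forall x, 0 <= h x) ->
  measurable_fun setT (relu_step rho h).
Proof.
move=> mh h0; apply: emeasurable_funD; apply: measurable_funeM => //.
apply: (@measurable_gamma_mean _ _ _ _ (fun u : R * R => h (u.1 + rho * u.2)%R)) => //.
apply: measurableT_comp => //; apply: measurable_funD => //.
exact: measurable_funM.
Qed.

Lemma iter_relu_step m rho h x : measurable_fun setT h -> (forall x, 0 <= h x) ->
  iter m (relu_step rho) h x =
  \sum_(n < m.+1) (qd q m n)%:E * gamma_mean n (fun t => h (x + rho * t)%R).
Proof.
elim: m h => [|m IH] h mh h0.
  by rewrite big_ord1 qd0 expr0 mul1e /gamma_mean mulr0 addr0.
(* The innermost operator is absorbed into [h]. Under the order n/2 mean it splits into the means of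
   orders n/2 and (n + 1)/2, which is the shape of [sum_qdS]. *)
rewrite iterSr IH; [|exact: measurable_relu_step|exact: relu_step_ge0].
rewrite -(@sum_qdS m (fun n => gamma_mean n (fun t => h (x + rho * t)%R))); last first.
  by move=> n; exact: gamma_mean_ge0.
apply: eq_bigr => n _; congr *%E.
have mx : measurable_fun setT (fun t => h (x + rho * t)%R).
  exact: measurable_affine_comp.
have mxx : measurable_fun setT (fun t =>
    gamma_mean 1 (fun u => h (x + rho * t + rho * u)%R)).
  apply: (@measurable_gamma_mean _ _ _ _ (fun u : R * R =>
    h (x + rho * u.1 + rho * u.2)%R)) => //.
  apply: measurableT_comp => //; apply: measurable_funD => //; last exact: measurable_funM.
  by apply: measurable_funD => //; exact: measurable_funM.
have xx0 t : 0 <= gamma_mean 1 (fun u => h (x + rho * t + rho * u)%R).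
  exact: gamma_mean_ge0.
rewrite /relu_step gamma_meanD.
- congr +%E; first by apply: gamma_meanZ => //; rewrite lee_fin ltW.
  apply: (etrans (gamma_meanZ n _ mxx xx0)); first by rewrite lee_fin.
  congr *%E; apply: etrans (gamma_meanS n mx (fun t => h0 _)).
  apply: eq_gamma_mean => t; apply: eq_gamma_mean => u.
  by rewrite mulrDr addrA.
- exact: measurable_funeM.
- exact: measurable_funeM.
- by move=> t; rewrite mule_ge0// lee_fin ltW.
- by move=> t; rewrite mule_ge0// lee_fin.
Qed.

Lemma iter_relu_step_powR m rho s : (0 <= rho)%R -> (0 < s)%R ->
  iter m (relu_step rho) (fun t => (t `^ (s / 2))%:E) 0%R =
  (rho `^ (s / 2) * \sum_(1 <= n < m.+1)
     qd q m n * (Gamma (n%:R / 2 + s / 2) / Gamma (n%:R / 2)))%:E.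
Proof.
move=> rho0 s0; rewrite iter_relu_step; last 2 first.
- exact: measurable_powR_EFin.
- by move=> t; rewrite lee_fin powR_ge0.
(* The term n = 0 is a positive power of 0, which is why the sum in [I0q] starts at 1. *)
rewrite big_ord_recl [X in _ * X + _](_ : _ = 0) ?mule0 ?add0e; last first.
  by rewrite /gamma_mean mulr0 add0r powR0// gt_eqF// divr_gt0.
rewrite big_add1 /= big_mkord mulr_sumr -sumEFin; apply: eq_bigr => n _.
rewrite (eq_gamma_mean _ (g := fun t => ((rho * t) `^ (s / 2))%:E)); last first.
  by move=> t; rewrite add0r.
by rewrite gamma_mean_powR ?divr_ge0 ?(ltW s0)// -EFinM mulrCA.
Qed.

End relu_step.

(** * Integrating out an independent variable *)

Section independence.
Context d (T : measurableType d) (R : realType) (P : probability T R).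
Context (I : eqType) (X : I -> T -> R).
Hypothesis mX : forall i, measurable_fun setT (X i).
Hypothesis indX : mutually_independent P X.
Implicit Types (S : set I) (a : I).
Local Open Scope ereal_scope.

(** A pi-system made of the very events on which [mutually_independent] evaluates P. *)
Definition cylinders S : set (set T) :=
  [set A | exists (s : seq I) (B : I -> set R),
    [/\ uniq s, (forall i, i \in s -> S i), (forall i, measurable (B i)) &
        A = \bigcap_(i in [set` s]) (X i @^-1` B i)]].

(* T with the sigma-algebra generated by the variables X i, i in S. *)
Definition info S := g_sigma_algebraType (cylinders S).

Lemma cylinders_setT S : cylinders S setT.
Proof.
exists [::], (fun=> setT); split => //.
by rewrite (_ : [set` _] = set0) ?bigcap_set0//; apply/seteqP; split.
Qed.

Lemma cylinders_setI S : setI_closed (cylinders S).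
Proof.
move=> _ _ [s1 [B1 [u1 S1 m1 ->]]] [s2 [B2 [u2 S2 m2 ->]]].
(* An index absent from one of the lists is left unconstrained by it. *)
exists (undup (s1 ++ s2)), (fun i => (if i \in s1 then B1 i else setT) `&`
  (if i \in s2 then B2 i else setT)); split.
- exact: undup_uniq.
- by move=> i; rewrite mem_undup mem_cat => /orP[/S1|/S2].
- by move=> i; apply: measurableI; case: ifP.
apply/seteqP; split => [w [h1 h2] i /=|w h].
  by rewrite mem_undup mem_cat => _; split; case: ifP => // si; [exact: h1|exact: h2].
split => i /= si.
- have : [set` undup (s1 ++ s2)] i by rewrite /= mem_undup mem_cat si.
  by move/h => -[]; rewrite si.
- have : [set` undup (s1 ++ s2)] i by rewrite /= mem_undup mem_cat si orbT.
  by move/h => -[_]; rewrite si.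
Qed.

Lemma measurable_cylinders S A : cylinders S A -> measurable A.
Proof.
move=> [s [B [_ _ mB ->]]]; apply: fin_bigcap_measurable; first exact: finite_seq.
by move=> i _; rewrite -[X in measurable X]setTI; exact: mX.
Qed.

Lemma measurable_id_info S : measurable_fun setT (id : T -> info S).
Proof.
apply: (@measurability _ _ T (info S) setT id (cylinders S)) => //.
by move=> _ [A cA <-]; rewrite setTI; exact: (measurable_cylinders cA).
Qed.

Lemma measurable_info_sub S S' : S `<=` S' ->
  measurable_fun setT (id : info S' -> info S).
Proof.
move=> SS'; apply: (@measurability _ _ (info S') (info S) setT id (cylinders S)) => //.
move=> _ [_ [s [B [us sS mB ->]]] <-]; rewrite setTI.
apply: sub_sigma_algebra; exists s, B; split => // i /sS; exact: SS'.
Qed.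

Lemma measurable_info S a : S a -> measurable_fun setT (X a : info S -> R).
Proof.
move=> Sa _ A mA; rewrite setTI; apply: sub_sigma_algebra.
exists [:: a], (fun=> A); split => //.
- by move=> i; rewrite inE => /eqP ->.
apply/seteqP; split => [w h i /=|w h]; first by rewrite inE => /eqP ->.
by apply: (h a); rewrite /= inE.
Qed.

(** The identity into the coarser space packs the whole past into one random element, whose law can
    be a factor of a product measure. *)
Let idRV S : {RV P >-> info S} :=
  HB.pack (id : T -> info S)
    (isMeasurableFun.Build _ _ _ _ (id : T -> info S) (@measurable_id_info S)).

(** As functions of [C], both sides are finite measures. They agree on cylinders, where [a] joins
    the list as a new index because it lies outside [S], hence on the generated sigma-algebra. *)
Lemma independent_info S a A (C : set (info S)) : ~ S a ->
  measurable A -> measurable C ->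
  P (X a @^-1` A `&` C) = P (X a @^-1` A) * P C.
Proof.
move=> Sa mA mC.
have mXA : measurable (X a @^-1` A) by rewrite -[X in measurable X]setTI; exact: mX.
pose m0 : {measure set T -> \bar R} := mrestr P mXA.
pose m1 : {measure set (info S) -> \bar R} :=
  pushforward m0 (id : T -> info S).
have r0 : (0 <= fine (P (X a @^-1` A)))%R by exact: fine_ge0.
pose m2 : {measure set (info S) -> \bar R} :=
  mscale (NngNum r0) (distribution P (idRV S)).
have Pfin (B : set T) : measurable B -> P B = (fine (P B))%:E.
  by move=> mB; rewrite fineK// fin_num_measure.
suff h : m1 (@measurable_id_info S) C = m2 C.
  by rewrite setIC (Pfin _ mXA); exact: h.
apply: (@measure_unique _ R (info S) (cylinders S) (fun=> setT) _ _ _ _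
  (m1 (@measurable_id_info S)) m2 _ _ C mC) => //.
- exact: cylinders_setI.
- by move=> _; exact: cylinders_setT.
- by rewrite bigcup_const.
- move=> B cB; have mB := measurable_cylinders cB.
  rewrite /m1 /m2 /pushforward/= /m0 /mrestr /mscale/= /distribution /pushforward/=.
  case: cB => s [F [us sS mF BE]].
  pose F' i := if i == a then A else F i.
  have as_ : a \notin s by apply/negP => /sS.
  have Fs i : i \in s -> F' i = F i.
    by rewrite /F'; case: eqP => // ->; rewrite (negbTE as_).
  have mF' i : measurable (F' i) by rewrite /F'; case: ifP.
  have -> : B `&` X a @^-1` A = \bigcap_(i in [set` a :: s]) (X i @^-1` F' i).
    rewrite BE; apply/seteqP; split => [w [h Aw] i /=|w h].
      rewrite inE => /predU1P[->|si]; first by rewrite /F' eqxx.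
      by rewrite Fs//; exact: h.
    split => [i /= si|].
      by have := h i; rewrite /= inE si orbT Fs//; exact.
    by have := h a; rewrite /= inE eqxx /F' eqxx; exact.
  rewrite indX//=; last by rewrite as_.
  rewrite BE indX// big_cons /F' eqxx EFinM; congr (_ * _%:E).
  by rewrite !big_seq; apply: eq_bigr => i si; rewrite -/(F' i) Fs.
- move=> _; have : P ([set: T] `&` X a @^-1` A) < +oo.
    by rewrite setTI ltey_eq fin_num_measure.
  exact.
Qed.

(** The joint law of X a and the past is a product on rectangles, hence everywhere; Tonelli then
    integrates X a out with the past frozen. *)
Lemma integral_independent S a (nu : probability R R)
    (f : R * info S -> \bar R) : ~ S a ->
  (forall A, measurable A -> P (X a @^-1` A) = nu A) ->
  measurable_fun setT f -> (forall u, 0 <= f u) ->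
  \int[P]_w f (X a w, w) = \int[P]_w \int[nu]_y f (y, w).
Proof.
move=> Sa nuE mf f0.
have mXid : measurable_fun setT (fun w : T => (X a w, w) : R * info S).
  by apply: measurable_fun_pair; [exact: mX|exact: measurable_id_info].
pose XRV : {RV P >-> (R * info S)%type} :=
  HB.pack (fun w : T => (X a w, w) : R * info S)
    (isMeasurableFun.Build _ _ _ _
       (fun w : T => (X a w, w) : R * info S) mXid).
transitivity (\int[distribution P XRV]_u f u).
  by rewrite ge0_integral_distribution.
transitivity (\int[nu \x distribution P (idRV S)]_u f u).
  apply: eq_measure_integral => A mA _; apply/esym.
  apply: product_measure_unique => //= B C mB mC.
  by rewrite -nuE//; exact: (independent_info Sa mB mC).
rewrite fubini_tonelli2// ge0_integral_distribution//.
- exact: measurable_fun_fubini_tonelli_G.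
- by move=> w; apply: integral_ge0.
Qed.

End independence.

(** * The law of one layer *)

Lemma measurable_sum_in d (T : measurableType d) (R : realType) (I : eqType)
    (s : seq I) (h : I -> T -> R) :
  (forall i, i \in s -> measurable_fun setT (h i)) ->
  measurable_fun setT (fun x => \sum_(i <- s) h i x).
Proof.
elim: s => [|i s IH] hs.
  rewrite (_ : (fun _ => _) = cst 0)//.
  by apply/funext => x; rewrite big_nil.
under eq_fun do rewrite big_cons.
apply: measurable_funD; first by apply: hs; rewrite mem_head.
by apply: IH => j js; apply: hs; rewrite inE js orbT.
Qed.

Lemma measurable_relu (R : realType) : measurable_fun setT (@relu R).
Proof. exact: measurable_maxr. Qed.

Lemma reluM (R : realType) (c z : R) : 0 <= c -> relu (c * z) = c * relu z.
Proof. by move=> c0; rewrite /relu -{1}(mulr0 c) maxr_pMr. Qed.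

Lemma measurable_slice (R : realType) d (T : measurableType d) (G : set (set T))
    (w : T) (g : R * g_sigma_algebraType G -> \bar R) :
  measurable_fun setT g -> measurable_fun setT (fun y : R => g (y, w)).
Proof. by move=> mg; exact: (measurable_fun_pair1 (w : g_sigma_algebraType G) mg). Qed.

(** The two measures live on [R] and on [measurableTypeR R]; pushing forward along the identity
    reconciles these types. *)
Lemma integral_distribution_normal (R : realType) d (T : measurableType d)
    (P : probability T R) (X : {RV P >-> R}) (m s : R) (f : R -> \bar R) :
  (forall A, measurable A -> distribution P X A = normal_prob m s A) ->
  measurable_fun setT f -> (forall x, 0 <= f x)%E ->
  (\int[distribution P X]_y f y = \int[normal_prob m s]_y f y)%E.
Proof.
move=> XN mf f0.
have mid : measurable_fun setT (id : measurableTypeR R -> R) by [].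
pose nu : {measure set R -> \bar R} :=
  pushforward (normal_prob m s) (id : measurableTypeR R -> R).
transitivity (\int[nu mid]_y f y)%E.
  by apply: eq_measure_integral => A mA _; exact: XN.
by rewrite /nu ge0_integral_pushforward// preimage_setT.
Qed.

Section relu_gauss_step.
Context {R : realType}.
Variable q : R.
Hypothesis q01 : (0 < q <= 1)%R.
Local Notation N := (@normal_prob R 0 1).
Local Open Scope ereal_scope.

Definition relu_gauss_step (tau : R) (h : R -> \bar R) (x : R) : \bar R :=
  (1 - q)%:E * h x + q%:E * \int[N]_z h (x + (relu (tau * z) / q) ^+ 2)%R.

(** An output vanishes through dropout, with mass 1 - q, or through ReLU, with mass q/2, in total 1
    - q/2. The scale of [relu_step] comes from (tau relu(z) / q)^2 = (2 tau^2 / q^2) (relu(z)^2 /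
    2). *)
Lemma relu_gauss_stepE (tau : R) (h : R -> \bar R) (x : R) : (0 <= tau)%R ->
  measurable_fun setT h -> (forall x, 0 <= h x) ->
  relu_gauss_step tau h x = relu_step q (2 * tau ^+ 2 / q ^+ 2) h x.
Proof.
move=> tau0 mh h0; rewrite /relu_gauss_step /relu_step.
set rho := (2 * _ / _)%R; have /andP[q0 q1] := q01.
have mx : measurable_fun setT (fun t => h (x + rho * t)%R) by exact: measurable_affine_comp.
have -> : \int[N]_z h (x + (relu (tau * z) / q) ^+ 2)%R =
    (2^-1)%:E * h x + (2^-1)%:E * gamma_mean 1 (fun t => h (x + rho * t)%R).
  transitivity (\int[N]_z h (x + rho * (relu z ^+ 2 / 2))%R).
    apply: eq_integral => z _; congr (h (_ + _)%R).
    by rewrite reluM// /rho; field; rewrite gt_eqF.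
  apply: (etrans (normal_prob_sqr_relu mx (fun t => h0 _))).
  by rewrite mulr0 addr0 /gamma_mean muleA -EFinM mul1r.
set G := gamma_mean _ _; have G0 : 0 <= G by exact: gamma_mean_ge0.
have h20 : (0 <= 2^-1 :> R)%R by rewrite invr_ge0.
rewrite ge0_muleDr; [|by rewrite mule_ge0|by rewrite mule_ge0].
rewrite addeA !muleA -!EFinM; congr +%E.
rewrite -ge0_muleDl ?lee_fin ?subr_ge0 ?mulr_ge0 ?(ltW q0)// -EFinD.
by congr (_%:E * _); field.
Qed.

End relu_gauss_step.

Section network.
Context (R : realType) (dT : measure_display) (T : measurableType dT).
Context (P : probability T R) (d : nat) (q sigma : R).
Context (W : nat -> 'I_d -> 'I_d -> {RV P >-> R}) (eps : nat -> 'I_d -> {RV P >-> R}).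
Hypothesis q01 : (0 < q <= 1)%R.
Hypothesis sigma0 : (0 < sigma)%R.
Hypothesis WN : forall k i j A, measurable A ->
  distribution P (W k i j) A = normal_prob 0 sigma A.
Hypothesis epsD : forall k i, P (eps k i @^-1` [set 0]) = (1 - q)%:E /\
  P (eps k i @^-1` [set q^-1]) = q%:E.
Let X := all_vars (fun k i j => W k i j : T -> R) (fun k i => eps k i : T -> R).
Hypothesis indX : mutually_independent P X.
Local Notation N := (@normal_prob R 0 1).
Local Open Scope ereal_scope.

Let mX a : measurable_fun setT (X a).
Proof. by case: a => [[[k i] j]|[k i]] /=; exact: measurable_funP. Qed.

Let q0 : (0 < q)%R. Proof. by case/andP: q01. Qed.
Let q1 : (0 <= 1 - q)%R. Proof. by case/andP: q01 => _; rewrite subr_ge0. Qed.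

(** The two atoms are distinct and already carry mass 1, so the complement of {0, 1/q} is null. *)
Lemma integral_dropout k i (f : R -> \bar R) :
  measurable_fun setT f -> (forall x, 0 <= f x) ->
  \int[distribution P (eps k i)]_e f e = (1 - q)%:E * f 0%R + q%:E * f q^-1%R.
Proof.
move=> mf f0; have [nu0 nu1] := epsD k i.
pose nu : probability _ R := distribution P (eps k i).
have {}nu0 : nu [set 0%R] = (1 - q)%:E := nu0.
have {}nu1 : nu [set q^-1%R] = q%:E := nu1.
rewrite -[LHS]/(\int[nu]_e f e).
have m0 (x : R) : measurable [set x] by exact: measurable_set1.
have disE : [set 0%R] `&` [set q^-1%R] = set0 :> set R.
  apply/seteqP; split => // x [/= -> ] /esym/eqP.
  by rewrite invr_eq0 gt_eqF.
have dis : [disjoint [set 0%R] & [set q^-1%R] : set R] by apply/disj_set2P.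
pose A : set R := [set 0%R] `|` [set q^-1%R].
have mA : measurable A by exact: measurableU.
have nuC : nu (~` A) = 0.
  rewrite probability_setC// [X in _ - X](_ : _ = 1) ?subee//.
  apply: (etrans (@measureU _ _ _ nu [set 0%R] [set q^-1%R] (m0 _) (m0 _) disE)).
  by apply: (etrans (congr2 +%E nu0 nu1)); rewrite -EFinD subrK.
have int1 (x : R) : \int[nu]_(y in [set x]) f y = f x * nu [set x].
  rewrite -integral_cst//; apply: eq_integral => y; rewrite inE => -> //.
rewrite -(setUv A) ge0_integral_setU//; last 3 first.
- exact: measurableC.
- exact: measurable_funTS.
- by apply/disj_set2P; rewrite setICr.
rewrite [X in _ + X](_ : _ = 0) ?adde0; last first.
  by apply: null_set_integral => //; [exact: measurableC|exact: measurable_funTS].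
rewrite ge0_integral_setU//; last exact: measurable_funTS.
by rewrite !int1 nu0 nu1 muleC [X in _ + X]muleC.
Qed.

Let info_snd S S' : S `<=` S' ->
  measurable_fun setT (fun u : R * info X S' => u.2 : info X S).
Proof.
move=> SS'.
exact: (measurableT_comp (@measurable_info_sub _ _ _ _ X S S' SS') measurable_snd).
Qed.

Lemma row_law S k i (r : seq 'I_d) (v : 'I_d -> T -> R) (g : R * info X S -> \bar R) :
  uniq r -> (forall j, ~ S (inl (k, i, j))) ->
  (forall j, measurable_fun setT (v j : info X S -> R)) ->
  measurable_fun setT g -> (forall u, 0 <= g u) ->
  \int[P]_w g ((\sum_(j <- r) W k i j w * v j w)%R, w) =
  \int[P]_w \int[N]_z g ((sigma * Num.sqrt (\sum_(j <- r) v j w ^+ 2) * z)%R, w).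
Proof.
move=> ur Sk mv; elim: r ur g => [|j r IH] /= ur g mg g0.
  apply: eq_integral => w _; rewrite !big_nil sqrtr0 mulr0.
  apply/esym; apply: etrans (integral_normal_prob_cst 0%R 1%R _).
  by apply: eq_integral => z _; rewrite mul0r.
have /andP[jr ur'] := ur.
(* The past enlarged by the weights still in the sum: [y0] is measurable for it, while the weight at
   j stays outside because j is not in r. *)
pose S' := S `|` [set a | exists2 j', j' \in r & a = inl (k, i, j')].
have SS' : S `<=` S' by move=> a Sa; left.
have aS' : ~ S' (inl (k, i, j)).
  by case => [/Sk//|[j' j'r [] jj']]; move: jr; rewrite jj' j'r.
pose y0 w := (\sum_(j' <- r) W k i j' w * v j' w)%R.
have mvS' j' : measurable_fun setT (v j' : info X S' -> R).
  exact: (measurableT_comp (mv j') (measurable_info_sub SS')).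
have my0 : measurable_fun setT (y0 : info X S' -> R).
  apply: measurable_sum_in => j' j'r; apply: measurable_funM => //.
  by apply: (@measurable_info _ _ _ _ X S' (inl (k, i, j'))); right; exists j'.
pose f (u : R * info X S') := g ((u.1 * v j u.2 + y0 u.2)%R, u.2).
have mf : measurable_fun setT f.
  apply: (measurableT_comp mg); apply: measurable_fun_pair; last exact: info_snd.
  apply: measurable_funD; last exact: (measurableT_comp my0 measurable_snd).
  by apply: measurable_funM => //; exact: (measurableT_comp (mvS' j) measurable_snd).
(* With the weight at j averaged out and the remaining sum as first argument, [g'] refers to the
   original past, so the induction hypothesis applies to it. *)
pose g' (u : R * info X S) := \int[N]_y g ((sigma * y * v j u.2 + u.1)%R, u.2).
have mg' : measurable_fun setT g'.
  pose h (t : (R * info X S) * R) := g ((sigma * t.2 * v j t.1.2 + t.1.1)%R, t.1.2).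
  have mh : measurable_fun setT h.
    have m12 : measurable_fun setT (fun t : (R * info X S) * R => t.1.2).
      exact: (measurableT_comp measurable_snd measurable_fst).
    apply: (measurableT_comp mg); apply: measurable_fun_pair => //.
    apply: measurable_funD; last exact: (measurableT_comp measurable_fst measurable_fst).
    apply: measurable_funM; last exact: (measurableT_comp (mv j) m12).
    exact: measurable_funM.
  exact: (@measurable_fun_fubini_tonelli_F _ _ _ _ _ N h mh (fun=> g0 _)).
have g'0 u : 0 <= g' u by apply: integral_ge0.
transitivity (\int[P]_w f (X (inl (k, i, j)) w, w)).
  by apply: eq_integral => w _; rewrite big_cons.
rewrite (@integral_independent _ _ _ _ _ _ mX indX S' _ (distribution P (W k i j)) f aS')//;
  last by move=> u; exact: g0.
transitivity (\int[P]_w g' (y0 w, w)).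
  apply: eq_integral => w _.
  have mfw : measurable_fun setT (fun y : R => f (y, w)) by exact: (measurable_slice w mf).
  apply: etrans (normal_prob_scale sigma0 mfw (fun y => g0 _)).
  exact: (integral_distribution_normal (@WN k i j) mfw (fun y => g0 _)).
rewrite (IH ur' g' mg' g'0); apply: eq_integral => w _; rewrite big_cons.
have mgw : measurable_fun setT (fun y : R => g (y, w)) by exact: (measurable_slice w mg).
set n := (\sum_(j' <- r) _)%R; have n0 : (0 <= n)%R by apply: sumr_ge0 => j' _; exact: sqr_ge0.
have a0 : (0 <= sigma * Num.sqrt n)%R by rewrite mulr_ge0 ?sqrtr_ge0// ltW.
(* Two independent centred Gaussians, with coefficients sigma sqrt n and sigma v_j, whose squares
   add up to the variance of the longer sum. *)
transitivity (\int[N]_z \int[N]_y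
    g ((sigma * Num.sqrt n * z + sigma * v j w * y)%R, w)).
  apply: eq_integral => z _; apply: eq_integral => y _ /=.
  by congr (g (_, _)); ring.
apply: (etrans (normal_prob_add (sigma * v j w)%R a0 mgw (fun y => g0 _))).
apply: eq_integral => z _; congr (g ((_ * _)%R, _)).
rewrite !exprMn sqr_sqrtr// -mulrDr sqrtrM ?sqr_ge0// sqrtr_sqr gtr0_norm//.
by rewrite addrC.
Qed.

(** The dropout variable is integrated first, being outside the past enlarged by the weights of row
    i. What is left depends on the preactivation and the past only, as [row_law] requires. *)
Lemma neuron_law S k i (v : 'I_d -> T -> R) (g : R * info X S -> \bar R) :
  (forall j, ~ S (inl (k, i, j))) -> ~ S (inr (k, i)) ->
  (forall j, measurable_fun setT (v j : info X S -> R)) ->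
  measurable_fun setT g -> (forall u, 0 <= g u) ->
  \int[P]_w g ((relu (\sum_j W k i j w * v j w) * eps k i w)%R, w) =
  \int[P]_w ((1 - q)%:E * g (0%R, w) + q%:E *
     \int[N]_z g ((relu (sigma * Num.sqrt (\sum_j v j w ^+ 2) * z) / q)%R, w)).
Proof.
move=> Sk Se mv mg g0.
pose S' := S `|` [set a | exists j, a = inl (k, i, j)].
have SS' : S `<=` S' by move=> a Sa; left.
have aS' : ~ S' (inr (k, i)) by case=> [/Se//|[j]].
pose y0 w := (\sum_j W k i j w * v j w)%R.
have my0 : measurable_fun setT (y0 : info X S' -> R).
  apply: measurable_sum_in => j _; apply: measurable_funM.
    by apply: (@measurable_info _ _ _ _ X S' (inl (k, i, j))); right; exists j.
  exact: (measurableT_comp (mv j) (measurable_info_sub SS')).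
pose f (u : R * info X S') := g ((relu (y0 u.2) * u.1)%R, u.2).
have mf : measurable_fun setT f.
  apply: (measurableT_comp mg); apply: measurable_fun_pair; last exact: info_snd.
  apply: measurable_funM => //; apply: (measurableT_comp (@measurable_relu R)).
  exact: (measurableT_comp my0 measurable_snd).
pose g' (u : R * info X S) :=
  (1 - q)%:E * g (0%R, u.2) + q%:E * g ((relu u.1 / q)%R, u.2).
have mg' : measurable_fun setT g'.
  apply: emeasurable_funD; apply: measurable_funeM; apply: (measurableT_comp mg);
    apply: measurable_fun_pair => //.
  apply: measurable_funM => //.
  exact: (measurableT_comp (@measurable_relu R) measurable_fst).
have g'0 u : 0 <= g' u.
  by rewrite /g' adde_ge0// mule_ge0// lee_fin// ltW.
transitivity (\int[P]_w f (X (inr (k, i)) w, w)); first exact: eq_integral.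
rewrite (@integral_independent _ _ _ _ _ _ mX indX S' _ (distribution P (eps k i)) f aS')//;
  last by move=> u; exact: g0.
transitivity (\int[P]_w g' (y0 w, w)).
  apply: eq_integral => w _.
  have mfw : measurable_fun setT (fun y : R => f (y, w)) by exact: (measurable_slice w mf).
  by rewrite (integral_dropout k i mfw (fun y => g0 _)) /f /g'/= mulr0.
rewrite (@row_law S k i (index_enum 'I_d) v g')// ?index_enum_uniq//.
apply: eq_integral => w _.
set tau := (sigma * Num.sqrt _)%R.
have mgw : measurable_fun setT (fun z : R => g ((relu (tau * z) / q)%R, w)).
  apply: (measurableT_comp (measurable_slice w mg)).
  apply: measurable_funM => //; apply: (measurableT_comp (@measurable_relu R)).
  exact: measurable_funM.
rewrite /g'/= ge0_integralD//.
- congr +%E; first exact: integral_normal_prob_cst.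
  by rewrite ge0_integralZl// lee_fin ltW.
- by move=> z _; rewrite mule_ge0// lee_fin.
- by move=> z _; rewrite mule_ge0// lee_fin ltW.
- exact: measurable_funeM.
Qed.

Lemma layer_law S k (r : seq 'I_d) (v : 'I_d -> T -> R) (h : R * info X S -> \bar R) :
  uniq r -> (forall i j, ~ S (inl (k, i, j))) -> (forall i, ~ S (inr (k, i))) ->
  (forall j, measurable_fun setT (v j : info X S -> R)) ->
  measurable_fun setT h -> (forall u, 0 <= h u) ->
  \int[P]_w h ((\sum_(i <- r)
     (relu (\sum_j W k i j w * v j w) * eps k i w) ^+ 2)%R, w) =
  \int[P]_w iter (size r)
    (relu_step q (2 * (sigma * Num.sqrt (\sum_j v j w ^+ 2)) ^+ 2 / q ^+ 2))
    (fun x => h (x, w)) 0%R.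
Proof.
move=> ur Sk Se mv; elim: r ur h => [|i r IH] /= ur h mh h0.
  by apply: eq_integral => w _; rewrite big_nil.
have /andP[ir ur'] := ur.
(* All weights and dropout variables of the remaining neurons: their sum [y] counts as past while
   neuron i is averaged out. *)
pose S' := S `|` [set a | exists2 i', i' \in r &
  (exists j, a = inl (k, i', j)) \/ a = inr (k, i')].
have SS' : S `<=` S' by move=> a Sa; left.
have aW j : ~ S' (inl (k, i, j)).
  by case=> [/Sk//|[i' i'r [[j' [] ii' _]|//]]]; move: ir; rewrite ii' i'r.
have aE : ~ S' (inr (k, i)).
  by case=> [/Se//|[i' i'r [[//]|[] ii']]]; move: ir; rewrite ii' i'r.
have mvS' j : measurable_fun setT (v j : info X S' -> R).
  exact: (measurableT_comp (mv j) (measurable_info_sub SS')).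
pose y w := (\sum_(i <- r) (relu (\sum_j W k i j w * v j w) * eps k i w) ^+ 2)%R.
have my : measurable_fun setT (y : info X S' -> R).
  apply: measurable_sum_in => i' i'r; apply: measurable_funX; apply: measurable_funM.
    apply: (measurableT_comp (@measurable_relu R)); apply: measurable_sum_in => j _.
    apply: measurable_funM => //.
    apply: (@measurable_info _ _ _ _ X S' (inl (k, i', j))); right; exists i' => //.
    by left; exists j.
  by apply: (@measurable_info _ _ _ _ X S' (inr (k, i'))); right; exists i' => //; right.
pose g (u : R * info X S') := h ((y u.2 + u.1 ^+ 2)%R, u.2).
have mg : measurable_fun setT g.
  apply: (measurableT_comp mh); apply: measurable_fun_pair; last exact: info_snd.
  apply: measurable_funD; first exact: (measurableT_comp my measurable_snd).
  exact: measurable_funX.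
pose tau w := (sigma * Num.sqrt (\sum_j v j w ^+ 2))%R.
have mtau : measurable_fun setT (tau : info X S -> R).
  apply: measurable_funM => //; apply: (measurableT_comp
    (continuous_measurable_fun (@sqrt_continuous R))).
  by apply: measurable_sum_in => j _; exact: measurable_funX.
have tau0 w : (0 <= tau w)%R by rewrite mulr_ge0 ?sqrtr_ge0// ltW.
(* The scale [tau] is random but measurable for the past, so [h'] is again an admissible test
   function of sum and past. *)
pose h' (u : R * info X S) := relu_gauss_step q (tau u.2) (fun x => h (x, u.2)) u.1.
have mh' : measurable_fun setT h'.
  apply: emeasurable_funD; apply: measurable_funeM.
    by apply: (measurableT_comp mh); apply: measurable_fun_pair.
  pose e (t : (R * info X S) * R) :=
    h ((t.1.1 + (relu (tau t.1.2 * t.2) / q) ^+ 2)%R, t.1.2).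
  have me : measurable_fun setT e.
    have m12 : measurable_fun setT (fun t : (R * info X S) * R => t.1.2).
      exact: (measurableT_comp measurable_snd measurable_fst).
    apply: (measurableT_comp mh); apply: measurable_fun_pair => //.
    apply: measurable_funD; first exact: (measurableT_comp measurable_fst measurable_fst).
    apply: measurable_funX; apply: measurable_funM => //.
    apply: (measurableT_comp (@measurable_relu R)); apply: measurable_funM => //.
    exact: (measurableT_comp mtau m12).
  exact: (@measurable_fun_fubini_tonelli_F _ _ _ _ _ N e me (fun=> h0 _)).
have h'0 u : 0 <= h' u.
  apply: adde_ge0; apply: mule_ge0 => //; first by rewrite lee_fin ltW.
  exact: integral_ge0.
transitivity (\int[P]_w g ((relu (\sum_j W k i j w * v j w) * eps k i w)%R, w)).
  by apply: eq_integral => w _; rewrite big_cons addrC.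
rewrite (@neuron_law S' k i v g)//; last by move=> u; exact: h0.
transitivity (\int[P]_w h' (y w, w)).
  by apply: eq_integral => w _; rewrite /g/= expr0n addr0.
rewrite (IH ur' h' mh' h'0); apply: eq_integral => w _.
(* The removed neuron acts directly on [h], as the innermost operator. All operators coincide
   because the neurons share the input v. *)
rewrite -iterS iterSr; congr (iter _ _ _ _); apply/funext => x.
rewrite /h'/= relu_gauss_stepE//.
exact: (measurable_slice w mh).
Qed.

End network.

(** * Moments of the network *)

Section gain.
Context {R : realType}.
Implicit Types (q s p sigma : R) (d n : nat).

(** Young's inequality for the product of u and 1 with conjugate exponents k and k / (k - 1),
    multiplied by k. *)
Lemma bernoulli_powR (u k : R) : 0 <= u -> 1 < k -> k * u <= u `^ k + (k - 1).
Proof.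
move=> u0 k1; have k0 : 0 < k by exact: lt_trans ltr01 k1.
have l0 : 0 < k / (k - 1) by rewrite divr_gt0// subr_gt0.
have kn0 : k != 0 by rewrite gt_eqF.
have k1n0 : k - 1 != 0 by rewrite subr_eq0 gt_eqF.
have kl : k^-1 + (k / (k - 1))^-1 = 1 by field; rewrite ?kn0 ?k1n0.
have := conjugate_powR u0 ler01 k0 l0 kl.
rewrite mulr1 powR1 div1r => /(ler_wpM2l (ltW k0)); rewrite mulrDr mulrCA divff ?mulr1 ?gt_eqF//.
suff -> : k * (k / (k - 1))^-1 = k - 1 by [].
by field; rewrite ?kn0 ?k1n0.
Qed.

Lemma sqr_powR_half (c s : R) : 0 <= c -> (c ^+ 2) `^ (s / 2) = c `^ s.
Proof.
move=> c0; rewrite -powR_mulrn// -powRrM; congr powR.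
by field.
Qed.

Lemma sqrt_powR (c s : R) : 0 <= c -> Num.sqrt c `^ s = c `^ (s / 2).
Proof. by move=> c0; rewrite -powR12_sqrt// -powRrM mulrC. Qed.

(** The right side is the moment given by [iter_relu_step_powR] for an input of norm 1. *)
Lemma gainE q s d sigma : 0 < q -> 0 < sigma ->
  sigma `^ s * I0q q s d =
  (2 * sigma ^+ 2 / q ^+ 2) `^ (s / 2) *
  \sum_(1 <= n < d.+1) qd q d n * (Gamma (n%:R / 2 + s / 2) / Gamma (n%:R / 2)).
Proof.
move=> q0 s0; rewrite /I0q mulrA; congr *%R.
have A : 0 <= 2 * sigma ^+ 2 by rewrite mulr_ge0// sqr_ge0.
have B : 0 <= (q ^+ 2)^-1 by rewrite invr_ge0 sqr_ge0.
rewrite (powRM _ A B) (powRM _ (ler0n R 2) (sqr_ge0 sigma)).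
rewrite (sqr_powR_half _ (ltW s0)).
rewrite powRVl ?sqr_ge0// powRN (sqr_powR_half _ (ltW q0)).
by rewrite mulrA [sigma `^ s * _]mulrC.
Qed.

Let Gamma_ratio_gt0 n s : (0 < n)%N -> 0 < s ->
  0 < Gamma (n%:R / 2 + s / 2) / Gamma (n%:R / 2) :> R.
Proof.
move=> n0 s0; have n2 := half_le_natr n0 :> (2^-1 <= n%:R / 2 :> R).
by rewrite divr_gt0// Gamma_gt0// (le_trans n2)// lerDl divr_ge0// ltW.
Qed.

(** The term n = 1, present since d > 0, is strictly positive because q/2 < 1. *)
Lemma I0q_gt0 q s d : (0 < d)%N -> 0 < q <= 1 -> 0 < s -> 0 < I0q q s d.
Proof.
move=> d0 q01 s0; have /andP[q0 q1] := q01.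
rewrite /I0q mulr_gt0 ?divr_gt0 ?powR_gt0// big_ltn ?ltnS// ltr_pwDl//.
  rewrite mulr_gt0 ?Gamma_ratio_gt0// /qd bin1 !mulr_gt0 ?ltr0n ?exprn_gt0 ?divr_gt0//.
  by lra.
rewrite big_nat_cond sumr_ge0// => n /andP[/andP[n2 _] _].
by rewrite mulr_ge0 ?qd_ge0// ltW// Gamma_ratio_gt0// (leq_trans _ n2).
Qed.

Lemma sum_qd q d : \sum_(0 <= n < d.+1) qd q d n = 1.
Proof.
transitivity (((1 - q / 2) + q / 2) ^+ d); last by rewrite subrK expr1n.
rewrite exprDn big_mkord; apply: eq_bigr => n _.
by rewrite /qd -mulr_natr; ring.
Qed.

(** [bernoulli_powR] with u = (c t)^(s/2) and k = p/s, integrated against the Gamma law of order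
    n/2. *)
Lemma gamma_ratio_convex (n : nat) (s p c : R) : (0 < n)%N -> 0 < s -> s < p -> 0 <= c ->
  p / s * (c `^ (s / 2) * (Gamma (n%:R / 2 + s / 2) / Gamma (n%:R / 2))) <=
  c `^ (p / 2) * (Gamma (n%:R / 2 + p / 2) / Gamma (n%:R / 2)) + (p / s - 1).
Proof.
move=> n0 s0 sp c0; have p0 : 0 < p by exact: lt_trans sp.
have k1 : 1 < p / s by rewrite ltr_pdivlMr// mul1r.
have ct r : measurable_fun setT (fun t : R => ((c * t) `^ r)%:E).
  apply: (measurableT_comp (measurable_powR_EFin r)); exact: measurable_funM.
have pow0 (r t : R) : (0 <= ((c * t) `^ r)%:E)%E by rewrite lee_fin powR_ge0.
have k0 : (0 <= (p / s)%:E)%E by rewrite lee_fin divr_ge0 ?ltW.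
have k10 : (0 <= (p / s - 1)%:E)%E by rewrite lee_fin subr_ge0 ltW.
rewrite -lee_fin EFinD EFinM -!gamma_mean_powR ?divr_ge0 ?(ltW s0) ?(ltW p0)//.
rewrite -gamma_meanZ// -[in leRHS](gamma_mean_cst n k10) -gamma_meanD//.
apply: le_gamma_mean => //.
- exact: measurable_funeM.
- exact: emeasurable_funD.
- by move=> t; exact: mule_ge0.
- move=> t t0; rewrite -EFinM -EFinD lee_fin.
  have -> : p / 2 = s / 2 * (p / s) by field; rewrite gt_eqF.
  by rewrite (powRrM _ (s / 2) (p / s)); apply: bernoulli_powR; rewrite ?powR_ge0.
- by move=> t; exact: adde_ge0.
Qed.

(* Strictness comes from the mass (1 - q/2)^d that the one-layer
   gain puts at 0. *)
Lemma gain_gt1 q s p d sigma : (0 < d)%N -> 0 < q <= 1 -> 0 < s -> s < p ->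
  0 < sigma -> sigma `^ s * I0q q s d = 1 -> 1 < sigma `^ p * I0q q p d.
Proof.
move=> d0 q01 s0 sp sg0; have /andP[q0 q1] := q01.
rewrite !gainE//; set c := 2 * _ / _ => h.
have c0 : 0 <= c by apply: divr_ge0; [apply: mulr_ge0|]; rewrite ?sqr_ge0.
have k1 : 1 < p / s by rewrite ltr_pdivlMr// mul1r.
set rhs := ltRHS.
have : p / s <= rhs + (p / s - 1) * \sum_(1 <= n < d.+1) qd q d n.
  rewrite [leLHS](_ : _ = p / s * (c `^ (s / 2) * \sum_(1 <= n < d.+1)
      qd q d n * (Gamma (n%:R / 2 + s / 2) / Gamma (n%:R / 2)))); last by rewrite h mulr1.
  rewrite !mulr_sumr /rhs mulr_sumr -big_split/=.
  rewrite !big_nat; apply: ler_sum => n /andP[n0 _].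
  have := gamma_ratio_convex n0 s0 sp c0 => /(ler_wpM2l (@qd_ge0 _ _ q01 d n)).
  move: (_ / Gamma _) (_ / Gamma _) (qd q d n) => A B Q.
  by move: (p / s) (c `^ _) (c `^ _) => k a b; lra.
(* The weights from n = 1 on sum to 1 - (1 - q/2)^d, so the bound becomes rhs >= 1 + (p/s - 1) (1 -
   q/2)^d. *)
have := sum_qd q d; rewrite big_ltn// qd0 => Sq.
have : 0 < (1 - q / 2) ^+ d by rewrite exprn_gt0//; lra.
by nra.
Qed.

End gain.

(** * The moment recursion from layer to layer *)

Section network_moments.
Context (R : realType) (dT : measure_display) (T : measurableType dT).
Context (P : probability T R) (d : nat) (q sigma : R) (x0 : 'I_d -> R).
Context (W : nat -> 'I_d -> 'I_d -> {RV P >-> R}) (eps : nat -> 'I_d -> {RV P >-> R}).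
Hypothesis d0 : (0 < d)%N.
Hypothesis q01 : (0 < q <= 1)%R.
Hypothesis sigma0 : (0 < sigma)%R.
Hypothesis WN : forall k i j A, measurable A ->
  distribution P (W k i j) A = normal_prob 0 sigma A.
Hypothesis epsD : forall k i, P (eps k i @^-1` [set 0]) = (1 - q)%:E /\
  P (eps k i @^-1` [set q^-1]) = q%:E.
Let X := all_vars (fun k i j => W k i j : T -> R) (fun k i => eps k i : T -> R).
Hypothesis indX : mutually_independent P X.
Let x := net (fun k i j => W k i j : T -> R) (fun k i => eps k i : T -> R) x0.

(** The inequality is strict because variables of index l produce state l + 1: state k sees indices
    below k only. *)
Definition layers_before (k : nat) : set ((nat * 'I_d * 'I_d) + (nat * 'I_d))%type :=
  [set a | match a with inl (l, _, _) => (l < k)%N | inr (l, _) => (l < k)%N end].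

Lemma measurable_net k j :
  measurable_fun setT ((fun w => x k w j) : info X (layers_before k) -> R).
Proof.
elim: k j => [|k IH] i; first exact: measurable_cst.
have sub : layers_before k `<=` layers_before k.+1.
  by move=> [[[l i'] j']|[l i']] /= lk; exact: ltnW.
suff : measurable_fun setT ((fun w => relu (\sum_j W k i j w * x k w j) * eps k i w) :
  info X (layers_before k.+1) -> R) by [].
apply: measurable_funM.
  apply: (measurableT_comp (@measurable_relu R)); apply: measurable_sum_in => j _.
  apply: measurable_funM.
    exact: (@measurable_info _ _ _ _ X (layers_before k.+1) (inl (k, i, j)) (ltnSn k)).
  exact: (measurableT_comp (IH j) (@measurable_info_sub _ _ _ _ X _ _ sub)).
exact: (@measurable_info _ _ _ _ X (layers_before k.+1) (inr (k, i)) (ltnSn k)).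
Qed.

Let mX a : measurable_fun setT (X a).
Proof. by case: a => [[[k i] j]|[k i]] /=; exact: measurable_funP. Qed.

Lemma enorm_powR (y : 'I_d -> R) (s : R) : enorm y `^ s = (\sum_i y i ^+ 2) `^ (s / 2).
Proof. by rewrite /enorm sqrt_powR// sumr_ge0// => i _; exact: sqr_ge0. Qed.

Lemma measurable_net_moment k s : measurable_fun setT (fun w => (enorm (x k w) `^ s)%:E).
Proof.
apply/measurable_EFinP.
rewrite (_ : (fun w => _) = (fun w => (\sum_j x k w j ^+ 2) `^ (s / 2))); last first.
  by apply/funext => w; rewrite enorm_powR.
apply: (measurableT_comp (measurable_powR _)); apply: measurable_sum_in => j _.
apply: measurable_funX.
have mid : measurable_fun setT (id : T -> info X (layers_before k)).
  exact: measurable_id_info.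
exact: (measurableT_comp (@measurable_net k j) mid).
Qed.

(** [layer_law] is used with a test function of the sum alone. The scale is |x k|^2 times its value
    for a unit input, so its power s/2 releases the factor |x k|^s. *)
Lemma net_moment_step k s : 0 < s ->
  (\int[P]_w (enorm (x k.+1 w) `^ s)%:E =
   (sigma `^ s * I0q q s d)%:E * \int[P]_w (enorm (x k w) `^ s)%:E)%E.
Proof.
move=> s0; have /andP[q0 q1] := q01.
pose S := layers_before k.
pose h (u : R * info X S) : \bar R := (u.1 `^ (s / 2))%:E.
have mh : measurable_fun setT h.
  exact: (measurableT_comp (measurable_powR_EFin _) measurable_fst).
have h0 u : (0 <= h u)%E by rewrite lee_fin powR_ge0.
have SW i j : ~ S (inl (k, i, j)) by rewrite /S /layers_before/= ltnn.
have Se i : ~ S (inr (k, i)) by rewrite /S /layers_before/= ltnn.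
have L := layer_law q01 sigma0 WN epsD indX (enum_uniq 'I_d) SW Se
  (@measurable_net k) mh h0.
rewrite size_enum_ord in L.
transitivity (\int[P]_w h ((\sum_(i <- enum 'I_d)
    (relu (\sum_j W k i j w * x k w j) * eps k i w) ^+ 2)%R, w))%E.
  by apply: eq_integral => w _; rewrite enorm_powR /h/= big_enum.
rewrite L -ge0_integralZl//; first last.
- by rewrite lee_fin mulr_ge0 ?powR_ge0// ltW// I0q_gt0.
- by move=> w _; rewrite lee_fin powR_ge0.
- exact: measurable_net_moment.
apply: eq_integral => w _.
have n0 : 0 <= \sum_j x k w j ^+ 2 by rewrite sumr_ge0// => j _; exact: sqr_ge0.
rewrite iter_relu_step_powR//; last first.
  by apply: divr_ge0; [apply: mulr_ge0|]; rewrite ?sqr_ge0.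
rewrite -EFinM gainE// enorm_powR; congr EFin; rewrite [RHS]mulrAC; congr *%R.
rewrite exprMn sqr_sqrtr// -powRM//; last first.
  by apply: divr_ge0; [apply: mulr_ge0|]; rewrite ?sqr_ge0.
by congr powR; ring.
Qed.

Lemma net_moment k s : 0 < s ->
  ('E_P[fun w => (enorm (x k w) `^ s)%R])%E =
  (enorm x0 `^ s * (sigma `^ s * I0q q s d) ^+ k)%:E.
Proof.
move=> s0; rewrite unlock; elim: k => [|k IH].
  apply: (etrans (integral_cst P (@measurableT _ T) (enorm x0 `^ s)%:E)).
  rewrite [X in (_ * X)%E](_ : _ = 1%E) ?mule1 ?expr0 ?mulr1//.
  exact: probability_setT.
by rewrite net_moment_step// IH -EFinM exprS mulrCA.
Qed.

End network_moments.

Theorem mainTheorem10 (R : realType) (dT : measure_display) (T : measurableType dT)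
    (P : probability T R) (d : nat) (q s sigma : R) (x0 : 'I_d -> R)
    (W : nat -> 'I_d -> 'I_d -> {RV P >-> R}) (eps : nat -> 'I_d -> {RV P >-> R}) :
  (0 < d)%N ->
  0 < q <= 1 ->
  0 < s ->
  0 < sigma ->
  (* W^(k+1)_{ij} ~ N(0, sigma^2) *)
  (forall k i j A, measurable A ->
     distribution P (W k i j) A = normal_prob 0 sigma A) ->
  (* eps^(k+1)_i = 0 w.p. 1-q and = 1/q w.p. q *)
  (forall k i, P (eps k i @^-1` [set 0]) = (1 - q)%:E /\
               P (eps k i @^-1` [set q^-1]) = q%:E) ->
  (* all weights and dropout variables are mutually independent *)
  mutually_independent P (all_vars (fun k i j => W k i j : T -> R)
                                   (fun k i => eps k i : T -> R)) ->
  let x := net (fun k i j => W k i j : T -> R) (fun k i => eps k i : T -> R) x0 in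
  (forall k, ('E_P[fun w => (enorm (x k w) `^ s)%R])%E =
             (enorm x0 `^ s * (sigma `^ s * I0q q s d) ^+ k)%:E) /\
  (x0 != 0 ->
    (* (i) *)
    (sigma = sigma_bar q s d ->
       (forall k, (1 <= k)%N -> ('E_P[fun w => (enorm (x k w) `^ s)%R])%E = (enorm x0 `^ s)%:E) /\
       (forall p, s < p -> exists C r : R, 0 < C /\ 1 < r /\ exists N : nat,
          forall k, (N <= k)%N ->
            ((C * r ^+ k)%:E <= ('E_P[fun w => (enorm (x k w) `^ p)%R])%E)%E)) /\
    (* (ii) *)
    (sigma < sigma_bar q s d ->
       exists C r : R, 0 < C /\ 0 < r < 1 /\ exists N : nat,
          forall k, (N <= k)%N ->
            (('E_P[fun w => (enorm (x k w) `^ s)%R])%E <= (C * r ^+ k)%:E)%E) /\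
    (* (iii) *)
    (sigma_bar q s d < sigma ->
       exists C r : R, 0 < C /\ 1 < r /\ exists N : nat,
          forall k, (N <= k)%N ->
            ((C * r ^+ k)%:E <= ('E_P[fun w => (enorm (x k w) `^ s)%R])%E)%E)).
Proof.
move=> d0 q01 s0 sigma0 WN epsD ind x.
have M k p : 0 < p -> ('E_P[fun w => (enorm (x k w) `^ p)%R])%E =
    (enorm x0 `^ p * (sigma `^ p * I0q q p d) ^+ k)%:E.
  by move=> p0; exact: net_moment.
split=> [k|x0n0]; first exact: M.
have n0 p : 0 < enorm x0 `^ p.
  apply: powR_gt0; rewrite /enorm sqrtr_gt0 lt_def sumr_ge0 ?andbT; last first.
    by move=> i _; exact: sqr_ge0.
  apply: contra x0n0 => /eqP h; apply/eqP/funext => i; apply/eqP.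
  rewrite -sqrf_eq0; apply/eqP.
  by apply: (psumr_eq0P _ h) => // j _; exact: sqr_ge0.
have I0 p : 0 < p -> 0 < I0q q p d by exact: I0q_gt0.
(* Hence comparing [sigma] with [sigma_bar] amounts to comparing the gain sigma^s I with 1. *)
have sbE : sigma_bar q s d `^ s = (I0q q s d)^-1.
  rewrite /sigma_bar -powRrM mulNr mulVf ?gt_eqF// powR_inv1//.
  exact/ltW/I0.
have sb0 : 0 <= sigma_bar q s d by exact: powR_ge0.
have powlt (a b : R) : 0 <= a -> a < b -> a `^ s < b `^ s.
  move=> a0 ab; apply: gt0_ltr_powR => //; rewrite nnegrE//.
  exact: le_trans (ltW ab).
split; [|split].
- move=> sE; have g1 : sigma `^ s * I0q q s d = 1.
    by rewrite sE sbE mulVf// gt_eqF// I0.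
  split=> [k _|p sp]; first by rewrite M// g1 expr1n mulr1.
  have p0 : 0 < p by exact: lt_trans sp.
  (* The moments are exactly geometric, so the initial moment and the gain serve as witnesses, with
     equality from k = 0 on; the other two cases do the same with s. *)
  exists (enorm x0 `^ p), (sigma `^ p * I0q q p d); split=> //; split.
    exact: gain_gt1 g1.
  by exists 0%N => k _; rewrite M.
- move=> sl; exists (enorm x0 `^ s), (sigma `^ s * I0q q s d); split=> //; split.
    rewrite mulr_gt0 ?powR_gt0 ?I0//= -ltr_pdivlMr ?I0// div1r -sbE.
    by apply: powlt => //; exact: ltW.
  by exists 0%N => k _; rewrite M.
- move=> sl; exists (enorm x0 `^ s), (sigma `^ s * I0q q s d); split=> //; split.
    by rewrite -ltr_pdivrMr ?I0// div1r -sbE; exact: powlt.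
  by exists 0%N => k _; rewrite M.
Qed.
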